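(* Suppose that $\sigma\colon 2^S\to\mathbb{R}_{>0}$, $\lambda\in\Lambda$, $X\in\lambda$, and $L\in S_\lambda$. (a) $N_W(W_L)$ acts on $e_L^\sigma\,\mathbb{C}W_L$ by right multiplication and $$E_\lambda^\sigma\cong\mathrm{Ind}_{N_W(W_L)}^W\left(e_L^\sigma\,\mathbb{C}W_L\right).$$ (b) $N_W(W_X)$ acts on $A_X$ and $$A_\lambda\cong\mathrm{Ind}_{N_W(W_X)}^W(A_X).$$
   Context: $V$ is a finite-dimensional complex vector space with a positive definite Hermitian form $\langle\cdot,\cdot\rangle$, and $W\subseteq\mathrm{GL}(V)$ is a finite Coxeter group preserving the form, with Coxeter generating set $S$ (each $s\in S$ acts as a reflection of order two; $m_{s,t}$ is the order of $st$; $\ell$ is the length function). $\mathrm{Fix}(W)^\perp$ has a basis $\Delta=\{\alpha_s:s\in S\}$ with $\langle\alpha_s,\alpha_t\rangle=-\cos(\pi/m_{s,t})$ such that $s$ is the reflection through the hyperplane $H_s$ orthogonal to $\alpha_s$. For $I\subseteq S$: $\Delta_I=\{\alpha_s:s\in I\}$, $W_I=\langle I\rangle$, $X_I=\bigcap_{s\in I}H_s$ ($X_\emptyset=V$), $W^I=\{w\in W:\ell(ws)>\ell(w)\ \forall s\in I\}$, $x_I=\sum_{w\in W^I}w\in\mathbb{C}W$. Write ${}^wJ=wJw^{-1}$. For $\sigma\colon 2^S\to\mathbb{R}_{>0}$ and $J,K\subseteq S$, $m_{JK}^\sigma=\sum_{w\in W^K,\ w(\Delta_J)\subseteq\Delta}\sigma({}^wJ)$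 if $J\subseteq K$ and $m_{JK}^\sigma=0$ otherwise; the elements $e_J^\sigma\in\mathbb{C}W$ are uniquely defined by $x_K=\sum_{J\subseteq S}m_{JK}^\sigma e_J^\sigma$ for all $K\subseteq S$. $T$ is the set of reflections in $W$, $H_t=\mathrm{Fix}(t)$; $L(\mathcal{A})$ is the set of all intersections of hyperplanes $H_t$, $t\in T$ (including $V$); $\Lambda$ is the set of $W$-orbits on $L(\mathcal{A})$; $W_X$ is the pointwise stabilizer of $X$ in $W$. For $\lambda\in\Lambda$: $S_\lambda=\{I\subseteq S:X_I\in\lambda\}$, $e_\lambda^\sigma=\sum_{I\in S_\lambda}\sigma(I)e_I^\sigma$, $E_\lambda^\sigma=e_\lambda^\sigma\,\mathbb{C}W$ (a right $\mathbb{C}W$-module). $A$ is the $\mathbb{C}$-algebra with generators $a_t$ ($t\in T$) and relations $a_{t_1}a_{t_2}=-a_{t_2}a_{t_1}$ for $t_1,t_2\in T$ and $\sum_{i=1}^p(-1)^ia_{t_1}\cdots\widehat{a_{t_i}}\cdots a_{t_p}=0$ whenever $\{H_{t_1},\dots,H_{t_p}\}$ is linearly dependent; $W$ acts on the left by algebra automorphisms, $wa_t=a_{wtw^{-1}}$. $A_X$ is the span of all $a_{t_1}\cdots a_{t_r}$ with $H_{t_1}\cap\dots\cap H_{t_r}=X$ (with $A_V=\mathbb{C}$), and $A_\lambda=\bigoplus_{X\in\lambda}A_X$ (a left $\mathbb{C}W$-module). *)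

(* Defs.v *)
From HB Require Import structures.
From mathcomp Require Import all_boot all_order all_algebra all_fingroup.
From mathcomp Require Import all_field ring_quotient sesquilinear.
From mathcomp Require Import complex.
From mathcomp Require Import boolp classical_sets reals trigo.

Set Implicit Arguments.
Unset Strict Implicit.
Unset Printing Implicit Defensive.

Import Order.TTheory GRing.Theory Num.Theory.
Local Open Scope ring_scope.
Local Open Scope complex_scope.
Local Open Scope quotient_scope.

Section Span.
Variables (K : fieldType) (V : lmodType K).

(* The ambient module need not be finite dimensional, so {vspace V} is not
   available here. *)
Definition lspan (P : V -> Prop) : {pred V} := fun v =>
  `[< exists n (c : 'I_n -> K) (u : 'I_n -> V),
        (forall i, P (u i)) /\ v = \sum_(i < n) c i *: u i >].

Fact lspan_submod_closed P : submod_closed (lspan P).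
Proof.
split=> [|a u v /asboolP[m [c [x [Px ->]]]] /asboolP[n [d [y [Py ->]]]]].
  apply/asboolP; exists 0, (fun=> 0), (fun=> 0).
  by split=> [[]//|]; rewrite big_ord0.
apply/asboolP; exists (m + n)%N.
exists (fun i => match split i with inl j => a * c j | inr j => d j end).
exists (fun i => match split i with inl j => x j | inr j => y j end).
split=> [i|]; first by case: (split i).
rewrite big_split_ord /= scaler_sumr; congr (_ + _); apply: eq_bigr => i _.
  by rewrite (unsplitK (inl i)) scalerA.
by rewrite (unsplitK (inr i)).
Qed.

HB.instance Definition _ P :=
  GRing.isSubmodClosed.Build K V (lspan P) (lspan_submod_closed P).

Record lspan_sub (P : V -> Prop) : Type :=
  LspanSub { lspan_val : V; _ : lspan_val \in lspan P }.
HB.instance Definition _ P := [isSub for @lspan_val P].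
HB.instance Definition _ P := [Choice of lspan_sub P by <:].
HB.instance Definition _ P :=
  [SubChoice_isSubLmodule of lspan_sub P by <:].

End Span.

Section LmodQuotient.
Variables (K : fieldType) (V : lmodType K) (P : V -> Prop).

(* V modulo the span of P. *)
Definition lquot : Type := {ideal_quot lspan P}.
HB.instance Definition _ := GRing.Zmodule.on lquot.

Definition lquot_pi (v : V) : lquot := \pi_({ideal_quot lspan P}) v.
Definition lquot_repr (x : lquot) : V := generic_quotient.repr (x : {ideal_quot lspan P}).
Definition lquot_scale (a : K) (x : lquot) : lquot :=
  lquot_pi (a *: lquot_repr x).

Lemma lquot_reprK x : lquot_pi (lquot_repr x) = x.
Proof. exact: reprK. Qed.

Lemma lquot_eqP u v : reflect (lquot_pi u = lquot_pi v) (u - v \in lspan P).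
Proof. by rewrite Quotient.idealrBE; apply: eqP. Qed.

Lemma lquot_piD u v : lquot_pi (u + v) = lquot_pi u + lquot_pi v.
Proof. exact: (Quotient.pi_add (lspan P)). Qed.

Lemma lquot_piZ a u : lquot_pi (a *: u) = lquot_scale a (lquot_pi u).
Proof.
apply/lquot_eqP; rewrite -scalerBr; apply: rpredZ.
by apply/lquot_eqP; rewrite lquot_reprK.
Qed.

Fact lquot_scaleA a b x :
  lquot_scale a (lquot_scale b x) = lquot_scale (a * b) x.
Proof. by rewrite -[x]lquot_reprK -!lquot_piZ scalerA. Qed.

Fact lquot_scale1 : left_id 1 lquot_scale.
Proof. by move=> x; rewrite -[x]lquot_reprK -lquot_piZ scale1r. Qed.

Fact lquot_scaleDr : right_distributive lquot_scale +%R.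
Proof.
move=> a x y; rewrite -[x]lquot_reprK -[y]lquot_reprK.
by rewrite -lquot_piD -!lquot_piZ scalerDr lquot_piD.
Qed.

Fact lquot_scaleDl x : {morph lquot_scale^~ x : a b / a + b}.
Proof.
by move=> a b; rewrite -[x]lquot_reprK -!lquot_piZ scalerDl lquot_piD.
Qed.

HB.instance Definition _ := GRing.Zmodule_isLmodule.Build K lquot
  lquot_scaleA lquot_scale1 lquot_scaleDr lquot_scaleDl.

End LmodQuotient.

Section GroupAlgebra.
Variables (K : fieldType) (G : finGroupType).

Definition galg : Type := {ffun G -> K^o}.
HB.instance Definition _ := Vector.on galg.

Definition gelt (g : G) : galg := [ffun x => (x == g)%:R].

Definition galg_mul (u v : galg) : galg :=
  [ffun g => \sum_h (u h : K) * v (h^-1 * g)%g].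

Fact galg_mulA : associative galg_mul.
Proof.
move=> u v w; apply/ffunP => g; rewrite !ffunE.
under eq_bigr do rewrite ffunE mulr_sumr.
under [RHS]eq_bigr do rewrite ffunE mulr_suml.
rewrite [RHS]exchange_big /=; apply: eq_bigr => h _.
rewrite [RHS](reindex_inj (mulgI h)) /=; apply: eq_bigr => k _.
by rewrite mulKg invMg mulrA mulgA.
Qed.

Fact galg_mul1l : left_id (gelt 1) galg_mul.
Proof.
move=> u; apply/ffunP => g; rewrite ffunE (bigD1 1%g) //= big1 => [|h hN1].
  by rewrite ffunE eqxx mul1r invg1 mul1g addr0.
by rewrite ffunE (negbTE hN1) mul0r.
Qed.

Fact galg_mul1r : right_id (gelt 1) galg_mul.
Proof.
move=> u; apply/ffunP => g; rewrite ffunE (bigD1 g) //= big1 => [|h hNg].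
  by rewrite ffunE mulVg eqxx mulr1 addr0.
by rewrite ffunE -eq_mulVg1 (negbTE hNg) mulr0.
Qed.

Fact galg_mulDl : left_distributive galg_mul +%R.
Proof.
move=> u v w; apply/ffunP => g; rewrite !ffunE -big_split /=.
by apply: eq_bigr => h _; rewrite ffunE mulrDl.
Qed.

Fact galg_mulDr : right_distributive galg_mul +%R.
Proof.
move=> u v w; apply/ffunP => g; rewrite !ffunE -big_split /=.
by apply: eq_bigr => h _; rewrite ffunE mulrDr.
Qed.

Fact galg_oner_neq0 : gelt 1 != 0.
Proof.
by apply/eqP => /ffunP/(_ 1%g)/eqP; rewrite !ffunE eqxx oner_eq0.
Qed.

HB.instance Definition _ := GRing.Zmodule_isNzRing.Build galg
  galg_mulA galg_mul1l galg_mul1r galg_mulDl galg_mulDr galg_oner_neq0.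

Fact galg_scaleAl (a : K) (u v : galg) : a *: (u * v) = (a *: u) * v.
Proof.
apply/ffunP => g; rewrite !ffunE scaler_sumr.
by apply: eq_bigr => h _; rewrite ffunE; apply: mulrA.
Qed.

Fact galg_scaleAr (a : K) (u v : galg) : a *: (u * v) = u * (a *: v).
Proof.
apply/ffunP => g; rewrite !ffunE scaler_sumr.
by apply: eq_bigr => h _; rewrite ffunE; apply: mulrCA.
Qed.

HB.instance Definition _ := GRing.Lmodule_isLalgebra.Build K galg galg_scaleAl.
HB.instance Definition _ := GRing.Lalgebra_isAlgebra.Build K galg galg_scaleAr.
HB.instance Definition _ := Algebra_isFalgebra.Build K galg.

Definition galg_of (H : {set G}) : {vspace galg} :=
  <<[seq gelt h | h in H]>>%VS.

End GroupAlgebra.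

(* M is a left (resp. right) KH-module, given by its underlying K-module and by
   the action of the elements of H.  In CG (x) M the function f stands for the
   sum of the g (x) f g (resp. f g (x) g), so that gtens g m is g (x) m
   (resp. m (x) g); the quotient is the tensor product over KH. *)
Section Induction.
Variables (K : fieldType) (G : finGroupType) (H : {set G}) (M : lmodType K).

Definition gtens (g : G) (m : M) : {ffun G -> M} :=
  [ffun x => if x == g then m else 0].

Section Left.
Variable act : G -> M -> M.

Definition lInd_rel (f : {ffun G -> M}) : Prop := exists g h m,
  h \in H /\ f = gtens (g * h)%g m - gtens g (act h m).

Definition lInd : lmodType K := lquot lInd_rel.

Definition lInd_act (g : G) (x : lInd) : lInd :=
  lquot_pi _ [ffun y => lquot_repr x (g^-1 * y)%g].
End Left.

Section Right.
Variable act : M -> G -> M.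

Definition rInd_rel (f : {ffun G -> M}) : Prop := exists g h m,
  h \in H /\ f = gtens (h * g)%g m - gtens g (act m h).

Definition rInd : lmodType K := lquot rInd_rel.

Definition rInd_act (x : rInd) (g : G) : rInd :=
  lquot_pi _ [ffun y => lquot_repr x (y * g^-1)%g].
End Right.

End Induction.
Arguments lInd_act {K G} H {M} act g x.
Arguments rInd_act {K G} H {M} act x g.

Section ModuleIso.
Variables (K : fieldType) (G : finGroupType) (M N : lmodType K).

Definition lmod_iso (actM : G -> M -> M) (actN : G -> N -> N) : Prop :=
  exists f : {linear M -> N},
    bijective f /\ forall g m, f (actM g m) = actN g (f m).

Definition rmod_iso (actM : M -> G -> M) (actN : N -> G -> N) : Prop :=
  exists f : {linear M -> N},
    bijective f /\ forall m g, f (actM m g) = actN (f m) g.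

End ModuleIso.

Section CoxeterSystem.
Variables (W : finGroupType) (S : {set W}).

(* W = < S | (s t) ^ m(s, t) = 1 >, where m(s, t) is the order of s t in W; the
   relations s ^ 2 = 1 are those with s = t. *)
Definition coxeter_system : Prop :=
  [/\ <<S>>%g = [set: W], forall s, s \in S -> #[s]%g = 2 &
  forall (G : groupType) (f : W -> G),
    (forall s t, s \in S -> t \in S -> ((f s * f t) ^+ #[s * t] = 1)%g) ->
    exists2 phi : W -> G,
      {morph phi : x y / (x * y)%g} & {in S, phi =1 f}].

(* S ^+ n is the set of products of n elements of S.  When S generates W, every
   element is a product of fewer than #|W| elements of S. *)
Definition coxeter_length (w : W) : nat :=
  find (fun n => w \in (S ^+ n)%g) (iota 0 #|W|).

Definition min_coset_reps (I : {set W}) : {set W} :=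
  [set w | [forall s in I, (coxeter_length w < coxeter_length (w * s)%g)%N]].

End CoxeterSystem.

Section ReflectionGroup.
Variables (R : realType) (V : vectType R[i]) (form : {dot V for conjc}).
Variables (W : finGroupType) (rho : W -> 'End(V)).
Implicit Types (I J K L S : {set W}) (X : {vspace V}).

Definition Fix (w : W) : {vspace V} := fixedSpace (rho w).

(* W is a subgroup of GL(V) through the faithful action rho; w v is rho w v. *)
Record coxeter_reflection_group (S : {set W}) (alpha : W -> V) : Prop := {
  crg_rho1 : rho 1%g = \1%VF;
  crg_rhoM : forall u v, rho (u * v)%g = (rho u \o rho v)%VF;
  crg_faithful : injective rho;
  crg_form : forall w x y, form (rho w x) (rho w y) = form x y;
  crg_coxeter : coxeter_system S;
  crg_hyperplane : forall s, s \in S -> Fix s = orthov form <[alpha s]>%VS;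
  crg_basis : basis_of (orthov form (\bigcap_(w : W) Fix w)%VS)
                       [seq alpha s | s in S];
  crg_gram : forall s t, s \in S -> t \in S ->
    form (alpha s) (alpha t) = (- cos (pi / #[s * t]%g%:R))%:C
}.

Definition reflections : {set W} := [set t | (\dim (Fix t)).+1 == \dim {:V}].

Definition lattice : set {vspace V} :=
  [set X | exists B : {set W},
     B \subset reflections /\ X = (\bigcap_(t in B) Fix t)%VS]%classic.

Definition orbit_of (X : {vspace V}) : set {vspace V} :=
  [set (rho w @: X)%VS | w in [set: W]%classic]%classic.

Definition lattice_orbits : set (set {vspace V}) :=
  [set orbit_of X | X in lattice]%classic.

Definition pstab X : {set W} := [set w | (X <= Fix w)%VS].

Definition X_ I : {vspace V} := (\bigcap_(s in I) Fix s)%VS.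

Section Descent.
Variables (S : {set W}) (alpha : W -> V) (sigma : {set W} -> R).

Definition x_ I : galg R[i] W := \sum_(w in min_coset_reps S I) gelt _ w.

Definition maps_simple (w : W) J : bool :=
  [forall s in J, [exists t in S, rho w (alpha s) == alpha t]].

(* J :^ w^-1 is w J w^-1 *)
Definition m_ J K : R :=
  if J \subset K then
    \sum_(w in min_coset_reps S K | maps_simple w J) sigma (J :^ w^-1)%g
  else 0.

Definition e_system (e : {set W} -> galg R[i] W) : Prop :=
  forall K, K \subset S ->
    x_ K = \sum_(J : {set W} | J \subset S) (m_ J K)%:C *: e J.

Definition S_ (lambda : set {vspace V}) : {set {set W}} :=
  [set I : {set W} | (I \subset S) && (X_ I \in lambda)].

Definition e_orb (e : {set W} -> galg R[i] W) (lambda : set {vspace V}) :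
  galg R[i] W := \sum_(I in S_ lambda) (sigma I)%:C *: e I.

Definition E_orb e lambda : {vspace galg R[i] W} :=
  (<[e_orb e lambda]> * fullv)%VS.

Definition eCW_ (e : {set W} -> galg R[i] W) L : {vspace galg R[i] W} :=
  (<[e L]> * galg_of _ <<L>>%g)%VS.

End Descent.

Section OrlikSolomon.

(* A hyperplane is identified with the line of its normal vectors. *)
Definition dependent_hyperplanes p (t : 'I_p -> W) : Prop :=
  exists2 v : p.-tuple V,
    forall i, <[tnth v i]>%VS = orthov form (Fix (t i)) & ~~ free v.

Definition os_relations (A : algType R[i]) (a : W -> A) : Prop :=
  (forall t1 t2, t1 \in reflections -> t2 \in reflections ->
     a t1 * a t2 = - (a t2 * a t1)) /\
  (forall p (t : 'I_p -> W), (forall i, t i \in reflections) ->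
     dependent_hyperplanes t ->
     \sum_(i < p) (-1) ^+ i.+1 * \prod_(j < p | j != i) a (t j) = 0).

(* A is the algebra presented by the generators a t, t in T, and the relations
   above; the values of a outside T are irrelevant. *)
Definition os_algebra (A : algType R[i]) (a : W -> A) : Prop :=
  os_relations a /\
  forall (B : algType R[i]) (b : W -> B), os_relations b ->
    (exists f : {lrmorphism A -> B}, {in reflections, forall t, f (a t) = b t})
    /\ (forall f g : {lrmorphism A -> B},
          {in reflections, forall t, f (a t) = g (a t)} -> f =1 g).

Definition os_action (A : algType R[i]) (a : W -> A)
    (act : W -> {lrmorphism A -> A}) : Prop :=
  forall w, {in reflections, forall t, act w (a t) = a (w * t * w^-1)%g}.

Variables (A : algType R[i]) (a : W -> A).

Definition os_monomial X (y : A) : Prop :=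
  exists ts : seq W, [/\ {subset ts <= reflections},
    (\bigcap_(t <- ts) Fix t)%VS = X & y = \prod_(t <- ts) a t].

Definition A_flat X : lmodType R[i] := lspan_sub (os_monomial X).

(* The A_X are independent, so that the span A_orb lambda of the union of the
   A_X, X in lambda, is their direct sum. *)
Definition os_orbit_part (lambda : set {vspace V}) (y : A) : Prop :=
  exists2 X, lambda X & y \in lspan (os_monomial X).

Definition A_orb lambda : lmodType R[i] := lspan_sub (os_orbit_part lambda).

End OrlikSolomon.

End ReflectionGroup.

(* Main.v *)
Require Import Defs.
From HB Require Import structures.
From mathcomp Require Import all_boot all_order all_algebra all_fingroup.
From mathcomp Require Import all_field ring_quotient sesquilinear.
From mathcomp Require Import complex.
From mathcomp Require Import boolp classical_sets reals trigo.

(** Both isomorphisms come from the same criterion: a module that contains a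
    copy of an [N]-module [M], is generated by it, and is the direct sum of the
    translates of [M] over the cosets of [N], is induced from [M]. It is enough
    to check that a vanishing sum of translates has a vanishing part over [N]
    itself ([rInd_iso] and [lInd_iso]).

    Orlik-Solomon algebra. For a subspace [Z], sending [a_t] to itself if
    [H_t] contains [Z] and to [0] otherwise respects the relations, because the
    product of a dependent family of generators is zero. The resulting
    endomorphism of [A] is the identity on [A_Y] if [Z] is contained in [Y] and
    zero otherwise ([os_projection]). For [Z = X] and [Y] in the orbit of [X],
    where all dimensions agree, it is the projection onto [A_X]. Since [X] is the
    fixed space of [W_X], the normalizer of [W_X] is the stabilizer of [X].

    Descent algebra. Tits' argument shows that [w alpha_s] is positive unless
    [w s] is shorter than [w], so that [W^I] is the set of the [w] which send the
    simple roots of [I] to positive roots; the combinatorics of coset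
    representatives then reduces to positivity of roots and indecomposability of
    simple roots. Write [f_I] for the part of [e_I] supported on [W_I]. The facts
    that carry the proof are the following.
    - [e_I = x_I f_I], since [x_K = x_I x_K^I] for [K] contained in [I], where
      [x_K^I] is the part of [x_K] supported on [W_I] ([e_factor]).
    - [e_(dK) d = e_K] if [d] sends the simple roots of [K] to simple roots
      ([e_conj]). As sets in [S_lambda] are matched in this way, all their [e_I]
      are right translates of [e_L].
    - [f_I x_J^I = 0] for [J] properly contained in [I] ([f_kill]); this is proved
      by induction on [I], using the decomposition of [x_J^I] along the cosets of
      [W_K], for [K] smaller than [I], and the compatibility [m_trans] of the
      coefficients [m_JK] with passing to [W_I].

    By the last fact [f_I x_L] is the sum of the [f_I d] over the [d] that match
    [L] with [I]. Hence [e_lambda x_L] is a nonzero multiple of [e_L], which with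
    the second fact gives [e_lambda C W = e_L C W]. Moreover left multiplication
    by [f_L] is injective on [e_L C W_L] and sends it to the group algebra of
    [N_W(W_L)], so that the translates of [e_L C W_L] over distinct cosets of
    [N_W(W_L)] are independent ([eCW_free]). *)

Set Implicit Arguments.
Unset Strict Implicit.
Unset Printing Implicit Defensive.

Import fintype finset.
Import Order.TTheory GRing.Theory Num.Theory.
Local Open Scope ring_scope.
Local Open Scope complex_scope.

(** * Orthogonal complements for a positive definite Hermitian form *)

Section OrthogonalComplement.
Variables (R : realType) (V : vectType R[i]) (form : {dot V for conjc}).

Lemma form_def u : form u u = 0 -> u = 0.
Proof.
move=> uu0; apply/eqP; apply: contraT => /(neq0_dnorm_gt0 (s := form)).
by rewrite uu0 ltxx.
Qed.

Lemma form_sym0 u v : form u v = 0 -> form v u = 0.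
Proof. by move=> /eqP; rewrite herm_eq0C => /eqP. Qed.

Lemma formDl u v w : form (u + v) w = form u w + form v w.
Proof. by rewrite linearDl. Qed.

Lemma formBl u v w : form (u - v) w = form u w - form v w.
Proof. by rewrite linearBl. Qed.

Lemma formZl k u w : form (k *: u) w = k * form u w.
Proof. by rewrite linearZl_LR. Qed.

Lemma mem_orthov_line u v : (u \in orthov form <[v]>%VS) = (form u v == 0).
Proof. exact: mem_orthov1. Qed.

Lemma dim_orthov (U : {vspace V}) :
  (\dim {:V} <= \dim U + \dim (orthov form U))%N.
Proof.
pose f u : 'rV[R[i]]_(\dim U) := \row_j form u (vbasis U)`_j.
have f_lin : linear f.
  by move=> k u v; apply/rowP => j; rewrite !mxE formDl formZl.
pose fL : {linear V -> 'rV[R[i]]_(\dim U)} :=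
  HB.pack f (GRing.isLinear.Build _ _ _ _ f f_lin).
pose g := linfun fL.
have gE u : g u = f u by rewrite lfunE.
have sub : (lker g <= orthov form U)%VS.
  apply/subvP => u; rewrite memv_ker gE => /eqP/rowP fu0.
  apply/mem_orthovP => v /coord_vbasis ->.
  rewrite linear_sumr big1 // => j _; rewrite linearZr_LR /=.
  by have := fu0 j; rewrite !mxE => ->; rewrite mulr0.
rewrite -(limg_ker_dim g fullv) capfv addnC leq_add ?dimvS //.
by apply: leq_trans (dimvS (subvf _)) _; rewrite dimvf /dim /= mul1n.
Qed.

(** A positive definite form is anisotropic on [U], so that [U] and its
    orthogonal complement span [V] by a count of dimensions. *)
Lemma orthovK (U : {vspace V}) : orthov form (orthov form U) = U.
Proof.
have UU : (U <= orthov form (orthov form U))%VS by rewrite orthov_sym.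
have cap0 : (U :&: orthov form U)%VS = 0%VS.
  apply/eqP; rewrite -subv0; apply/subvP => u; rewrite memv_cap memv0.
  by case/andP=> uU /mem_orthovP/(_ _ uU)/form_def ->.
apply/eqP; rewrite eqEsubv UU andbT; apply/subvP => x xUU.
have : x \in (U + orthov form U)%VS.
  suff -> : (U + orthov form U)%VS = fullv by rewrite memvf.
  apply/eqP; rewrite eqEdim subvf /= dimv_disjoint_sum //.
  exact: dim_orthov.
case/memv_addP => u uU [v vU] xE.
suff v0 : v = 0 by rewrite xE v0 addr0.
apply: form_def; have vE : v = x - u by rewrite xE addrC addKr.
have xv : form x v = 0 by apply: (mem_orthovP xUU).
have uv : form u v = 0 by apply: form_sym0; apply: (mem_orthovP vU).
by rewrite {1}vE formBl xv uv subrr.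
Qed.

End OrthogonalComplement.

(** * Length and alternating words *)

Section Length.
Variables (W : finGroupType) (S : {set W}).
Hypothesis gen_simple : <<S>>%g = [set: W].
Hypothesis S2 : forall s, s \in S -> (s * s = 1)%g.

Local Notation len := (coxeter_length S).

Lemma coxeter_length_le n w : w \in (S ^+ n)%g -> (len w <= n)%N.
Proof.
move=> wSn; rewrite leqNgt; apply/negP => n_lt.
have nW : (n < #|W|)%N.
  by apply: leq_trans n_lt _; rewrite -[leqRHS](size_iota 0) find_size.
by have := before_find 0%N n_lt; rewrite nth_iota // add0n wSn.
Qed.

(** The definition of the length only looks for words with fewer than [#|W|]
    letters. This is enough: the sets of products of at most [n] generators grow
    strictly until they fill [W]. *)
Lemma mem_coxeter_length w : w \in (S ^+ len w)%g.
Proof.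
pose D n := \bigcup_(j < n.+1) (S ^+ j)%g.
have DP n x : reflect (exists2 j, (j <= n)%N & x \in (S ^+ j)%g) (x \in D n).
  apply: (iffP bigcupP) => [[j _ xj]|[j jn xj]].
    by exists j; rewrite // -ltnS.
  by exists (Ordinal (jn : (j < n.+1)%N)).
(* As soon as [D n = D n.+1], this set is stable under [S], hence equal to [W]. *)
have step n : D n = [set: W] \/ (n < #|D n|)%N.
  elim: n => [|n [DT|n_lt]].
  - by right; rewrite card_gt0; apply/set0Pn; exists 1%g; apply/DP; exists 0%N.
  - left; apply/eqP; rewrite -finset.subTset -DT; apply/subsetP => x /DP[j jn xj].
    by apply/DP; exists j; rewrite // leqW.
  - have DnS : D n \subset D n.+1.
      by apply/subsetP => x /DP[j jn xj]; apply/DP; exists j; rewrite // leqW.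
    have [DE|DN] := eqVneq (D n) (D n.+1); last first.
      right; apply: leq_ltn_trans n_lt _; apply: proper_card.
      by rewrite finset.properEneq DN.
    left; rewrite -DE; apply/eqP; rewrite -finset.subTset -gen_simple.
    apply/subsetP => x /gen_prodgP[m [c cS ->]]; elim: m c cS => [|m IH] c cS.
      by rewrite big_ord0; apply/DP; exists 0%N.
    rewrite big_ord_recr /=.
    have /DP[j jn xj] := IH (fun i => c (widen_ord (leqnSn m) i)) (fun i => cS _).
    rewrite DE; apply/DP; exists j.+1; first by rewrite ltnS.
    by rewrite expgSr mem_mulg.
have W_gt0 : (0 < #|W|)%N by apply/card_gt0P; exists 1%g.
have {step} : w \in D #|W|.-1.
  have [->|] := step #|W|.-1; first by rewrite inE.
  rewrite prednK // => W_le; suff -> : D #|W|.-1 = [set: W] by rewrite inE.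
  by apply/eqP; rewrite eqEcard finset.subsetT cardsT.
case/DP => j jW wj.
have : has (fun n => w \in (S ^+ n)%g) (iota 0 #|W|).
  apply/hasP; exists j => //; rewrite mem_iota add0n.
  by rewrite -[X in (_ < X)%N]prednK // ltnS.
move=> hasw; have := nth_find 0%N hasw.
by rewrite nth_iota ?add0n // -[X in (_ < X)%N](size_iota 0) -has_find.
Qed.

Lemma coxeter_lengthMl v p n :
  p \in (S ^+ n)%g -> (len (v * p) <= len v + n)%N.
Proof.
move=> pn; apply: coxeter_length_le; rewrite expgD.
by rewrite mem_mulg ?mem_coxeter_length.
Qed.

Lemma coxeter_lengthMs v s : s \in S -> (len (v * s) <= (len v).+1)%N.
Proof. by move=> sS; rewrite -addn1 coxeter_lengthMl ?expg1. Qed.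

Lemma coxeter_descent w :
  w != 1%g -> exists2 s, s \in S & (len (w * s) < len w)%N.
Proof.
move=> wN1; have := mem_coxeter_length w.
case E: (len w) => [|n]; first by rewrite expg0 inE (negbTE wN1).
rewrite expgSr => /mulsgP[u s un sS ->]; exists s => //.
by rewrite -mulgA S2 // mulg1 ltnS coxeter_length_le.
Qed.

(** Recursion is on the last letter, as words are stripped from the right. *)
Fixpoint alt (s t : W) k : W :=
  if k is k'.+1 then (alt t s k' * t)%g else 1%g.

Lemma alt_suffix s t j m : s \in S -> t \in S ->
  exists2 p, p \in (S ^+ j)%g & alt s t (j + m) = (p * alt s t m)%g.
Proof.
elim: m s t => [|m IH] s t sS tS.
  exists (alt s t j); last by rewrite addn0 mulg1.
  elim: j s t sS tS => [|j IH] s t sS tS; first by rewrite /= inE.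
  by rewrite expgSr /= mem_mulg ?IH.
by have [p pj pE] := IH t s tS sS; exists p; rewrite // addnS /= pE mulgA.
Qed.

(** For [k] the order of [s * t] this is the braid relation. *)
Lemma alt_expg s t k : s \in S -> t \in S ->
  ((alt t s k)^-1 * alt s t k = (s * t) ^+ k)%g.
Proof.
move=> sS tS; have sV : (s^-1 = s)%g by apply/eqP; rewrite eq_invg_mul S2.
have tV : (t^-1 = t)%g by apply/eqP; rewrite eq_invg_mul S2.
elim: k => [|k IH]; first by rewrite /= invg1 mulg1.
rewrite /= invMg sV !mulgA -(mulgA s).
have -> : ((alt s t k)^-1 * alt t s k = (t * s) ^+ k)%g.
  by rewrite -[LHS]invgK invMg invgK IH -expVgn invMg sV tV.
elim: k {IH} => [|k IH]; first by rewrite mulg1 expg1.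
by rewrite [in LHS]expgSr [in RHS]expgSr -IH !mulgA.
Qed.

(** Strip letters [t], [s], [t], ... from the right of [w] as long as the length
    drops. When this stops at [v], the next letter cannot shorten [v], and neither
    can the letter stripped last, as putting it back adds one to the length. *)
Lemma alt_strip w s t : s \in S -> t \in S -> ~~ (len (w * s) < len w)%N ->
  exists k v, [/\ w = (v * alt s t k)%g, len w = (len v + k)%N,
     ~~ (len (v * s) < len v)%N & ~~ (len (v * t) < len v)%N].
Proof.
move=> sS tS; move: {2}(len w).+1 (ltnSn (len w)) => n.
elim: n w s t sS tS => // n IH w s t sS tS wn ws.
have [wt|wt] := boolP (len (w * t) < len w)%N; last first.
  by exists 0%N, w; rewrite /= mulg1 addn0.
have wtt : (w * t * t)%g = w by rewrite -mulgA S2 // mulg1.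
have lenw : len w = (len (w * t)).+1.
  by apply/eqP; rewrite eqn_leq wt andbT -{1}wtt coxeter_lengthMs.
have [||k [v [vE lv vt vs]]] := IH (w * t)%g t s tS sS.
- exact: leq_trans wt _.
- by rewrite wtt -leqNgt ltnW.
by exists k.+1, v; split; rewrite //= ?mulgA -?vE ?wtt // lenw lv addnS.
Qed.

End Length.

(** * Roots *)

Section Roots.
Variables (R : realType) (V : vectType R[i]) (form : {dot V for conjc}).
Variables (W : finGroupType) (rho : W -> 'End(V)) (S : {set W}) (alpha : W -> V).
Hypothesis HW : coxeter_reflection_group form rho S alpha.

Local Notation len := (coxeter_length S).
Local Notation C := R[i].

Lemma rho1 v : rho 1%g v = v.
Proof. by rewrite (crg_rho1 HW) lfunE. Qed.

Lemma rhoM u w v : rho (u * w)%g v = rho u (rho w v).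
Proof. by rewrite (crg_rhoM HW) lfunE. Qed.

Lemma rhoK w : cancel (rho w) (rho w^-1%g).
Proof. by move=> v; rewrite -rhoM mulVg rho1. Qed.

Lemma rhoKV w : cancel (rho w^-1%g) (rho w).
Proof. by move=> v; rewrite -rhoM mulgV rho1. Qed.

Lemma rho_inj w : injective (rho w).
Proof. exact: can_inj (rhoK w). Qed.

Lemma rho_ext u w : (forall v, rho u v = rho w v) -> u = w.
Proof. by move=> uw; apply: (crg_faithful HW); apply/lfunP. Qed.

Lemma gen_simple : <<S>>%g = [set: W].
Proof. by have [] := crg_coxeter HW. Qed.

Lemma simple_sqr s : s \in S -> (s * s = 1)%g.
Proof.
have [_ S2 _] := crg_coxeter HW => /S2 s2.
by have := expg_order s; rewrite s2 expgS expg1.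
Qed.

Lemma simple_inv s : s \in S -> (s^-1 = s)%g.
Proof. by move=> sS; apply/eqP; rewrite eq_invg_mul simple_sqr. Qed.

Lemma form_alpha s : s \in S -> form (alpha s) (alpha s) = 1.
Proof.
by move=> sS; rewrite (crg_gram HW) // simple_sqr // order1 divr1 cospi opprK.
Qed.

(** [alpha s + s alpha s] is fixed by [s], hence orthogonal to [alpha s] and to
    its image [s alpha s], hence to itself. *)
Lemma alpha_opp s : s \in S -> rho s (alpha s) = - alpha s.
Proof.
move=> sS; pose v := alpha s + rho s (alpha s).
have sv : rho s v = v.
  by rewrite /v raddfD /= -rhoM simple_sqr // rho1 addrC.
have va : form v (alpha s) = 0.
  apply/eqP; rewrite -mem_orthov_line -(crg_hyperplane HW) //.
  exact/fixedSpaceP.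
have vsa : form v (rho s (alpha s)) = 0 by rewrite -{1}sv (crg_form HW).
apply/eqP; rewrite -addr_eq0 addrC; apply/eqP/(form_def (form := form)).
by rewrite -/v {2}/v raddfD /= va vsa addr0.
Qed.

Lemma rho_simple s v : s \in S ->
  rho s v = v - (2 * form v (alpha s)) *: alpha s.
Proof.
move=> sS; set k := form v (alpha s).
have vs : rho s (v - k *: alpha s) = v - k *: alpha s.
  apply/fixedSpaceP; rewrite -[fixedSpace _]/(Fix rho s) (crg_hyperplane HW) //.
  by rewrite mem_orthov_line formBl formZl form_alpha // mulr1 subrr.
rewrite -{1}(subrK (k *: alpha s) v) raddfD /= vs.
rewrite [rho s (k *: _)]linearZ /= alpha_opp //.
by rewrite scalerN mulrDl mul1r scalerDl opprD addrA.
Qed.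

Definition simple_tuple := map_tuple alpha (enum_tuple S).

Lemma simple_free : free simple_tuple.
Proof. by have /andP[_] := crg_basis HW. Qed.

Lemma nth_simple_tuple (i : 'I_#|S|) : simple_tuple`_i = alpha (enum_val i).
Proof.
by rewrite (nth_map (enum_default i)) -?cardE // -enum_val_nth.
Qed.

(** A total version of [coord], indexed by elements of [W] instead of positions
    in the enumeration of [S]. *)
Definition cf s v : C :=
  \sum_(i < #|S|) (enum_val i == s)%:R * coord simple_tuple i v.

Fact cf_linear s : linear_for *%R (cf s).
Proof.
move=> k u v; rewrite /cf mulr_sumr -big_split /=; apply: eq_bigr => i _.
by rewrite linearP /= mulrDr mulrCA.
Qed.
HB.instance Definition _ s :=
  GRing.isLinear.Build C V C *%R (cf s) (cf_linear s).

Lemma cfZ s k v : cf s (k *: v) = k * cf s v.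
Proof. by rewrite linearZ. Qed.

Lemma cf_alpha s t : t \in S -> cf s (alpha t) = (t == s)%:R.
Proof.
move=> tS; have -> : alpha t = simple_tuple`_(enum_rank_in tS t).
  by rewrite nth_simple_tuple enum_rankK_in.
rewrite /cf (bigD1 (enum_rank_in tS t)) //= big1 => [|i iN].
  by rewrite coord_free ?simple_free // eqxx mulr1 addr0 enum_rankK_in.
by rewrite coord_free ?simple_free // [_ == i]eq_sym (negbTE iN) mulr0.
Qed.

Lemma cf_sum (I : {set W}) (c : W -> C) s : I \subset S ->
  cf s (\sum_(t in I) c t *: alpha t) = if s \in I then c s else 0.
Proof.
move=> IS; rewrite linear_sum /=.
under eq_bigr => t tI do rewrite cfZ cf_alpha ?(subsetP IS) //.
case: ifP => sI; last first.
  rewrite big1 // => t tI; case: eqVneq tI => [->|_ _]; first by rewrite sI.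
  by rewrite mulr0.
rewrite (bigD1 s) //= eqxx mulr1 big1 ?addr0 // => t /andP[_ /negbTE->].
by rewrite mulr0.
Qed.

(** Membership in the span of the simple roots of [I], stated as the expansion
    by which positivity is tested. *)
Definition in_span (I : {set W}) v := v = \sum_(s in I) cf s v *: alpha s.

Lemma in_spanP (I : {set W}) (c : W -> C) :
  I \subset S -> in_span I (\sum_(t in I) c t *: alpha t).
Proof.
move=> IS; rewrite /in_span; apply: eq_bigr => s sI.
by rewrite cf_sum // sI.
Qed.

Lemma in_span_alpha (I : {set W}) s : I \subset S -> s \in I -> in_span I (alpha s).
Proof.
move=> IS sI; have -> : alpha s = \sum_(t in I) (t == s)%:R *: alpha t.
  rewrite (bigD1 s) //= eqxx scale1r big1 ?addr0 // => t /andP[_ /negbTE->].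
  by rewrite scale0r.
exact: in_spanP.
Qed.

Lemma in_spanD (I : {set W}) u v : in_span I u -> in_span I v -> in_span I (u + v).
Proof.
move=> uI vI; rewrite /in_span {1}uI {1}vI -big_split /=.
by apply: eq_bigr => s _; rewrite raddfD scalerDl.
Qed.

Lemma in_spanZ (I : {set W}) k u : in_span I u -> in_span I (k *: u).
Proof.
move=> uI; rewrite /in_span {1}uI scaler_sumr.
by apply: eq_bigr => s _; rewrite cfZ scalerA.
Qed.

Lemma in_spanN (I : {set W}) u : in_span I u -> in_span I (- u).
Proof. by rewrite -scaleN1r; apply: in_spanZ. Qed.

Lemma in_span_cf0 (I : {set W}) s v : I \subset S -> s \notin I ->
  in_span I v -> cf s v = 0.
Proof. by move=> IS sI ->; rewrite cf_sum // (negbTE sI). Qed.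

Lemma in_span_sub (I : {set W}) v : I \subset S -> in_span S v ->
  (forall s, s \in S -> s \notin I -> cf s v = 0) -> in_span I v.
Proof.
move=> IS vS v0; rewrite /in_span {1}vS (big_setID I) /= (finset.setIidPr IS).
rewrite [X in _ + X]big1 ?addr0 // => s /setDP[sS sI].
by rewrite v0 // scale0r.
Qed.

(** A simple reflection moves a vector by a multiple of its simple root. *)
Lemma rho_sub_span (I : {set W}) w v : I \subset S -> w \in <<I>>%g ->
  in_span I (rho w v - v).
Proof.
move=> IS /gen_prodgP[m [c cI ->]]; elim: m c cI v => [|m IH] c cI v.
  rewrite big_ord0 rho1 subrr /in_span big1 // => s _.
  by rewrite linear0 scale0r.
rewrite big_ord_recl rhoM rho_simple ?(subsetP IS) // addrAC.
apply: in_spanD; first exact: IH.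
by rewrite -scaleNr; apply/in_spanZ/in_span_alpha.
Qed.

Lemma rho_in_span (I : {set W}) w v : I \subset S -> w \in <<I>>%g ->
  in_span I v -> in_span I (rho w v).
Proof.
by move=> IS wI vI; rewrite -(subrK v (rho w v)); apply/in_spanD/vI/rho_sub_span.
Qed.

Lemma rho_in_spanS w v : in_span S v -> in_span S (rho w v).
Proof. by apply: rho_in_span; rewrite // gen_simple inE. Qed.

Lemma cf_rho_notin (I : {set W}) w v s : I \subset S -> w \in <<I>>%g ->
  s \notin I -> cf s (rho w v) = cf s v.
Proof.
move=> IS wI sI; apply/eqP; rewrite -subr_eq0 -raddfB /=.
by apply/eqP; apply: in_span_cf0 sI _; rewrite //; apply: rho_sub_span.
Qed.

Definition root v := exists w s, s \in S /\ v = rho w (alpha s).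

(** In [R[i]] the relation [0 <= c] includes that [c] is real. *)
Definition pos v := forall s, s \in S -> 0 <= cf s v.

Lemma root_alpha s : s \in S -> root (alpha s).
Proof. by exists 1%g, s; rewrite rho1. Qed.

Lemma root_rho w v : root v -> root (rho w v).
Proof. by case=> u [s [sS ->]]; exists (w * u)%g, s; rewrite rhoM. Qed.

Lemma rootN v : root v -> root (- v).
Proof.
case=> w [s [sS ->]]; exists (w * s)%g, s; split=> //.
by rewrite rhoM alpha_opp // raddfN.
Qed.

Lemma root_span v : root v -> in_span S v.
Proof. by case=> w [s [sS ->]]; apply/rho_in_spanS/in_span_alpha. Qed.

Lemma root_norm v : root v -> form v v = 1.
Proof. by case=> w [s [sS ->]]; rewrite (crg_form HW) form_alpha. Qed.

Lemma root_neq0 v : root v -> v != 0.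
Proof.
move=> /root_norm v1; apply: contra_eqT v1 => /negPn/eqP ->.
by rewrite linear0l eq_sym oner_eq0.
Qed.

Lemma pos_alpha s : s \in S -> pos (alpha s).
Proof. by move=> sS t tS; rewrite cf_alpha // ler0n. Qed.

Lemma posD u v : pos u -> pos v -> pos (u + v).
Proof. by move=> pu pv s sS; rewrite raddfD /= addr_ge0 ?pu ?pv. Qed.

Lemma posZ k v : 0 <= k -> pos v -> pos (k *: v).
Proof. by move=> k0 pv s sS; rewrite cfZ mulr_ge0 ?pv. Qed.

Lemma root_posN v : root v -> pos v -> pos (- v) -> False.
Proof.
move=> rv pv nv; have /negP[] := root_neq0 rv.
rewrite (root_span rv) big1 // => s sS; have := nv s sS.
rewrite raddfN /= oppr_ge0 => v_le0.
suff -> : cf s v = 0 by rewrite scale0r.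
by apply/eqP; rewrite eq_le v_le0 pv.
Qed.

Section Dihedral.
Variable theta : R.
Let sn k : C := (sin (k%:R * theta))%:C.

Fact sin_multiple_rec k : 2 * (cos theta)%:C * sn k.+1 = sn k.+2 + sn k.
Proof.
have -> : 2 = (2 : R)%:C :> C by rewrite rmorph_nat.
rewrite /sn -!rmorphM -rmorphD; congr (_%:C).
have -> : k.+2%:R * theta = k.+1%:R * theta + theta.
  by rewrite -[in LHS]natr1 mulrDl mul1r.
have -> : k%:R * theta = k.+1%:R * theta - theta.
  by rewrite -[in RHS]natr1 mulrDl mul1r addrK.
rewrite sinD sinB addrACA -mulr2n subrr addr0 mulrC.
by rewrite mulrA mulrDr mulr1 mulr2n -mulrDl.
Qed.

(** On the plane of [alpha s] and [alpha t], the product [s t] is a rotation by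
    twice [theta], and the coordinates of the images of a simple root satisfy the
    same recurrence as the sines of the multiples of [theta]. *)
Lemma rho_alt_alpha k s t : s \in S -> t \in S ->
    form (alpha s) (alpha t) = - (cos theta)%:C ->
    form (alpha t) (alpha s) = - (cos theta)%:C ->
  sn 1 *: rho (alt s t k) (alpha s)
    = sn k.+1 *: alpha (if odd k then t else s)
      + sn k *: alpha (if odd k then s else t).
Proof.
pose P k s t := sn 1 *: rho (alt s t k) (alpha s)
    = sn k.+1 *: alpha (if odd k then t else s)
      + sn k *: alpha (if odd k then s else t).
rewrite -/(P k s t) => sS tS st ts.
suff: P k s t /\ P k.+1 s t by case.
have refl u v : v \in S -> form (alpha u) (alpha v) = - (cos theta)%:C ->
    rho v (alpha u) = alpha u + (2 * (cos theta)%:C) *: alpha v.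
  by move=> vS uv; rewrite rho_simple // uv mulrN scaleNr opprK.
have sn0 : sn 0%N = 0 by rewrite /sn mul0r sin0.
elim: k s t sS tS st ts => [|k IH] s t sS tS st ts.
  split; rewrite /P /= ?rho1 ?sn0 ?scale0r ?addr0 //.
  rewrite mul1g refl // scalerDr scalerA [sn 1 * _]mulrC sin_multiple_rec.
  by rewrite sn0 addr0 addrC.
have [Pk PkS] := IH s t sS tS st ts; split=> //.
have [_ QkS] := IH t s tS sS ts st.
have rec : rho (alt s t k.+2) (alpha s)
    = (2 * (cos theta)%:C) *: rho (alt t s k.+1) (alpha t)
      - rho (alt s t k) (alpha s).
  rewrite -[alt s t k.+2]/(alt t s k.+1 * t)%g rhoM refl // raddfD /=.
  rewrite [rho _ (_ *: _)]linearZ /= addrC; congr (_ + _).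
  by rewrite rhoM alpha_opp // raddfN.
rewrite /P rec scalerBr Pk scalerA mulrC -scalerA QkS.
rewrite scalerDr !scalerA !sin_multiple_rec /= negbK !scalerDl opprD.
by case: (odd k) => /=; rewrite addrACA !addrK.
Qed.
End Dihedral.

End Roots.

(** * Positive roots and minimal coset representatives *)

Section Parabolic.
Variables (R : realType) (V : vectType R[i]) (form : {dot V for conjc}).
Variables (W : finGroupType) (rho : W -> 'End(V)) (S : {set W}) (alpha : W -> V).
Hypothesis HW : coxeter_reflection_group form rho S alpha.

Local Notation len := (coxeter_length S).
Local Notation C := R[i].
Local Notation cf := (cf S alpha).
Local Notation pos := (pos S alpha).
Local Notation root := (root rho S alpha).
Local Notation in_span := (in_span S alpha).
Local Notation mcr := (min_coset_reps S).
Local Notation rhoM := (rhoM HW).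

Let S2 := simple_sqr HW.
Let gS := gen_simple HW.

(** Tits' argument: split off the part of [w] in the dihedral group of [s] and
    of a last letter [t] of [w]; that part sends [alpha s] to a nonnegative
    combination of [alpha s] and [alpha t], to which induction applies. *)
Lemma root_pos w s : s \in S -> ~~ (len (w * s) < len w)%N ->
  pos (rho w (alpha s)).
Proof.
move=> sS; move: {2}(len w).+1 (ltnSn (len w)) => n.
elim: n w s sS => // n IH w s sS wn ws.
have [->|wN1] := eqVneq w 1%g; first by rewrite (rho1 HW); apply: pos_alpha HW _ _.
have [t tS wt] := coxeter_descent gS S2 wN1.
have sNt : s != t by apply: contraNneq ws => ->.
have [k [v [wE lw vs vt]]] := alt_strip gS S2 sS tS ws.
have k_gt0 : (0 < k)%N.
  case: k wE {lw} => // wE; move: wt vt.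
  by rewrite wE /= mulg1 => ->.
have ltvw : (len v < len w)%N by rewrite lw -[X in (X < _)%N]addn0 ltn_add2l.
have pvs : pos (rho v (alpha s)) by apply: IH => //; apply: leq_trans ltvw _.
have pvt : pos (rho v (alpha t)) by apply: IH => //; apply: leq_trans ltvw _.
set m := #[s * t]%g.
have stN1 : (s * t)%g != 1%g.
  by rewrite -eq_invg_mul (simple_inv HW).
have m_gt1 : (1 < m)%N by rewrite order_gt1.
(* Otherwise the braid relation provides a reduced word for [w] ending in [s]. *)
have ltkm : (k < m)%N.
  rewrite ltnNge; apply: contra ws => lemk.
  have [p pj pE] := alt_suffix (k - m) m sS tS.
  have braid : alt s t m = alt t s m.
    by apply/eqP; rewrite eq_sym eq_mulVg1 (alt_expg S2) // expg_order.
  have wsE : (w * s)%g = (v * (p * alt s t m.-1))%g.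
    rewrite wE -(subnK lemk) pE braid -[in alt t s m](prednK (ltnW m_gt1)) /=.
    by rewrite -!mulgA S2 // mulg1.
  rewrite wsE lw (leq_ltn_trans (coxeter_lengthMl gS (n := k - m + m.-1) v _)) //.
    rewrite expgD; apply: mem_mulg pj _.
    have [q qm qE] := alt_suffix m.-1 0 sS tS.
    by move: qE; rewrite addn0 /= mulg1 => ->.
  rewrite ltn_add2l -{2}(subnK lemk) ltn_add2l prednK //; exact: ltnW.
pose theta : R := pi / m%:R.
have st : form (alpha s) (alpha t) = - (cos theta)%:C.
  by rewrite (crg_gram HW) // rmorphN.
have ts : form (alpha t) (alpha s) = - (cos theta)%:C.
  rewrite (crg_gram HW) // rmorphN /theta /m -orderV invMg.
  by rewrite !(simple_inv HW).
have mN0 : m != 0%N by rewrite -lt0n ltnW.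
have m0 : (0 : R) < m%:R by rewrite ltr0n ltnW.
have sin_ge0 j : (j <= m)%N -> 0 <= (sin (j%:R * theta))%:C.
  move=> jm; rewrite lecR; have [->|j0] := eqVneq j 0%N; first by rewrite mul0r sin0.
  have [->|jNm] := eqVneq j m.
    by rewrite /theta mulrC divfK ?sinpi // gt_eqF.
  rewrite ltW // sin_gt0_pi // /theta mulrA divr_gt0 ?mulr_gt0 ?pi_gt0 ?ltr0n ?lt0n //=.
  by rewrite ltr_pdivrMr // mulrC ltr_pM2l ?pi_gt0 // ltr_nat ltn_neqAle jNm.
have sin1 : 0 < (sin (1%N%:R * theta))%:C.
  rewrite ltcR mul1r sin_gt0_pi // divr_gt0 ?pi_gt0 //=.
  by rewrite ltr_pdivrMr // -{1}[pi]mulr1 ltr_pM2l ?pi_gt0 // ltr1n.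
have E := rho_alt_alpha HW k sS tS st ts.
have {}E : rho w (alpha s) = ((sin (1%N%:R * theta))%:C)^-1 *:
    ((sin (k.+1%:R * theta))%:C *: rho v (alpha (if odd k then t else s))
      + (sin (k%:R * theta))%:C *: rho v (alpha (if odd k then s else t))).
  have sinN0 : (sin (1%N%:R * theta))%:C != 0 by rewrite gt_eqF.
  rewrite wE rhoM -[rho (alt s t k) _](scalerK sinN0) E linearZ /= raddfD /=.
  by rewrite ![rho v (_ *: _)]linearZ.
rewrite E; apply: posZ; first by rewrite invr_ge0 ltW.
by apply: posD; apply: posZ; rewrite ?sin_ge0 ?(ltnW ltkm) //; case: (odd k).
Qed.

Lemma rhoMs w s : s \in S -> rho (w * s)%g (alpha s) = - rho w (alpha s).
Proof. by move=> sS; rewrite rhoM (alpha_opp HW) // raddfN. Qed.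

Lemma root_pos_neg v : root v -> pos v \/ pos (- v).
Proof.
case=> w [s [sS ->]].
have [ws|ws] := boolP (len (w * s) < len w)%N; last by left; apply: root_pos.
right; rewrite -rhoMs //; apply: root_pos => //.
by rewrite -mulgA S2 // mulg1 -leqNgt ltnW.
Qed.

Lemma len_pos w s : s \in S -> (len w < len (w * s))%N <-> pos (rho w (alpha s)).
Proof.
move=> sS; split=> [ws|pws]; first by apply: root_pos; rewrite // -leqNgt ltnW.
apply: contraT => ws; suff []: False.
apply: (root_posN HW (v := rho w (alpha s))) => //; first by exists w, s.
rewrite -rhoMs //; apply: root_pos => //.
by rewrite -mulgA S2 // mulg1.
Qed.

Lemma mcrP (I : {set W}) w : I \subset S ->
  reflect (forall s, s \in I -> pos (rho w (alpha s))) (w \in mcr I).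
Proof.
move=> IS; rewrite inE; apply: (iffP forall_inP) => wI s sI;
  have sS := subsetP IS s sI; exact/(len_pos w sS)/wI.
Qed.

Lemma mcr1 (I : {set W}) : I \subset S -> 1%g \in mcr I.
Proof.
move=> IS; apply/mcrP => // s sI; rewrite (rho1 HW).
exact/(pos_alpha HW)/(subsetP IS).
Qed.

Lemma mcrS w : w \in mcr S -> w = 1%g.
Proof.
move=> /(mcrP w (subxx S)) wS; apply/eqP; apply: contraT => wN1.
have [s sS] := coxeter_descent gS S2 wN1.
by have /(len_pos w sS)/ltnW := wS s sS; rewrite leqNgt => /negP.
Qed.

Lemma mcr_pos (I : {set W}) w v : I \subset S -> w \in mcr I ->
  in_span I v -> pos v -> pos (rho w v).
Proof.
move=> IS /(mcrP w IS) wI vI pv; rewrite vI linear_sum /=.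
elim/big_ind: _ => [t tS|u u'|s sI]; first by rewrite raddf0.
  exact: posD.
by rewrite linearZ /=; apply: posZ; [apply/pv/(subsetP IS)|apply: wI].
Qed.

Lemma mcr_root (I : {set W}) w v : I \subset S -> w \in mcr I ->
  in_span I v -> root v -> pos (rho w v) <-> pos v.
Proof.
move=> IS wI vI rv; split; last exact: (mcr_pos IS).
move=> pwv; case: (root_pos_neg rv) => // nv; case: (root_posN HW (root_rho HW w rv) pwv).
have -> : - rho w v = rho w (- v) by rewrite raddfN.
by apply: (mcr_pos IS wI) nv; apply: in_spanN.
Qed.

(** Some coordinate of [v] outside [I] is positive, and [W_I] does not change
    it. *)
Lemma pos_notin_span (I : {set W}) u v : I \subset S -> u \in <<I>>%g ->
  root v -> pos v -> ~ in_span I v -> pos (rho u v).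
Proof.
move=> IS uI rv pv nI; case: (root_pos_neg (root_rho HW u rv)) => // nuv.
case: nI; apply: in_span_sub => //; first exact: root_span HW _ rv.
move=> s sS sI; apply/eqP; rewrite eq_le pv // andbT -oppr_ge0.
by rewrite -(cf_rho_notin HW v IS uI sI) -raddfN nuv.
Qed.

Lemma mcr_parabolic1 (I : {set W}) u : I \subset S -> u \in <<I>>%g ->
  u \in mcr I -> u = 1%g.
Proof.
move=> IS uI /(mcrP u IS) uP; apply: mcrS; apply/mcrP => // s sS.
have [sI|sI] := boolP (s \in I); first exact: uP.
apply: (pos_notin_span IS uI); first exact: root_alpha HW _ sS.
  exact: pos_alpha HW _ sS.
move=> sp; have := in_span_cf0 HW IS sI sp.
by rewrite (cf_alpha HW) // eqxx => /eqP; rewrite oner_eq0.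
Qed.

(** If [u] is not [1], some simple root of [I] is made negative by [u], and then
    by [v * u]. *)
Lemma mcr_uniq (I : {set W}) v u : I \subset S -> u \in <<I>>%g ->
  v \in mcr I -> (v * u)%g \in mcr I -> u = 1%g.
Proof.
move=> IS uI vI /(mcrP _ IS) vuI; apply: (mcr_parabolic1 IS uI).
apply/mcrP => // s sI; apply/(mcr_root IS vI).
- by apply: (rho_in_span HW) => //; apply: (in_span_alpha HW).
- by apply/(root_rho HW)/(root_alpha HW)/(subsetP IS).
by rewrite -rhoM; apply: vuI.
Qed.

(** A shortest element of the coset will do. *)
Lemma mcr_exists (I : {set W}) w : I \subset S ->
  exists2 u, u \in <<I>>%g & (w * u)%g \in mcr I.
Proof.
move=> IS; move: {2}(len w).+1 (ltnSn (len w)) => n.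
elim: n w => // n IH w wn.
have [wI|] := boolP (w \in mcr I); first by exists 1%g; rewrite ?group1 ?mulg1.
rewrite inE negb_forall_in => /exists_inP[s sI ws].
have sS := subsetP IS s sI.
have lt_ws : (len (w * s) < len w)%N.
  by apply: contraR ws => ws; apply/(len_pos w sS); apply: root_pos.
have [|u uI wsu] := IH (w * s)%g; first exact: leq_trans lt_ws _.
by exists (s * u)%g; [exact: groupM (mem_gen sI) uI | rewrite mulgA].
Qed.

Definition mrep (I : {set W}) w : W :=
  odflt w [pick v in mcr I | (v^-1 * w)%g \in <<I>>%g].

Lemma mrepP (I : {set W}) w : I \subset S ->
  mrep I w \in mcr I /\ ((mrep I w)^-1 * w)%g \in <<I>>%g.
Proof.
move=> IS; rewrite /mrep; case: pickP => [v /andP[]//|noP].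
have [u uI wu] := mcr_exists w IS.
by have := noP (w * u)%g; rewrite wu invMg mulgKV groupV uI.
Qed.

Lemma mrep_eq (I : {set W}) v u : I \subset S -> v \in mcr I ->
  u \in <<I>>%g -> mrep I (v * u)%g = v.
Proof.
move=> IS vI uI; have [] := mrepP (v * u)%g IS; set r := mrep _ _ => rI ru.
have rv : (r^-1 * v)%g \in <<I>>%g by rewrite -(mulgK u v) mulgA groupMr ?groupV.
have /(mcr_uniq IS rv rI) : (r * (r^-1 * v))%g \in mcr I by rewrite mulKVg.
by move/eqP; rewrite -eq_mulVg1 => /eqP.
Qed.

(** [W^K = W^I (W_I :&: W^K)]: an element of [W^I] preserves the signs of the
    roots in the span of the simple roots of [I]. *)
Lemma mcrM (K I : {set W}) v u : K \subset I -> I \subset S ->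
  v \in mcr I -> u \in <<I>>%g -> ((v * u)%g \in mcr K) = (u \in mcr K).
Proof.
move=> KI IS vI uI; have KS := subset_trans KI IS.
have sp s : s \in K -> in_span I (rho u (alpha s)).
  move=> sK; apply: (rho_in_span HW) => //.
  by apply: (in_span_alpha HW) => //; apply: (subsetP KI).
have rt s : s \in K -> root (rho u (alpha s)).
  by move=> sK; apply/(root_rho HW)/(root_alpha HW)/(subsetP KS).
apply/mcrP/mcrP => // uK s sK.
  by apply/(mcr_root IS vI (sp s sK) (rt s sK)); rewrite -rhoM; apply: uK.
by rewrite rhoM; apply/(mcr_root IS vI (sp s sK) (rt s sK))/uK.
Qed.

Lemma root_collinear v s : s \in S -> root v -> pos v ->
  (forall t, t \in S -> t != s -> cf t v = 0) -> v = alpha s.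
Proof.
move=> sS rv pv v0; have vE : v = cf s v *: alpha s.
  rewrite {1}(root_span HW rv) (bigD1 s) //= big1 ?addr0 // => t /andP[tS ts].
  by rewrite v0 // scale0r.
have := root_norm HW rv; rewrite vE formZl linearZr_LR /= (form_alpha HW) // mulr1.
rewrite -[conjc _]/(Num.conj _) -normCK ger0_norm; last exact: pv.
by move/eqP; rewrite sqrp_eq1 ?pv // => /eqP ->; rewrite scale1r.
Qed.

(** Simple roots are indecomposable: an element of [W^I] can only send a simple
    root of the parabolic subsystem of [I] to a simple root. *)
Lemma mcr_simple (I : {set W}) w v s : I \subset S -> w \in mcr I ->
  in_span I v -> root v -> s \in S -> rho w v = alpha s ->
  exists2 r, r \in I & v = alpha r.
Proof.
move=> IS wI vI rv sS wv.
have pv : pos v.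
  by apply/(mcr_root IS wI vI rv); rewrite wv; apply: (pos_alpha HW).
have /existsP[r /andP[rI cr]] : [exists r, (r \in I) && (cf r v != 0)].
  apply: contraT; rewrite negb_exists => /forallP noI.
  have /negP[] := root_neq0 HW rv; rewrite vI big1 // => r rI.
  by have := noI r; rewrite rI negbK => /eqP ->; rewrite scale0r.
exists r => //; apply: (rho_inj HW (w := w)); rewrite wv; apply/esym.
have rS := subsetP IS r rI.
apply: root_collinear => //; first by exists w, r.
  by have /(mcrP w IS) := wI; apply.
move=> t tS tNs; have : cf t (rho w v) = 0.
  by rewrite wv (cf_alpha HW) // eq_sym (negbTE tNs).
rewrite vI !linear_sum /= => /eqP; rewrite psumr_eq0 => [|q qI].
  move/allP/(_ r (mem_index_enum _)); rewrite rI /= linearZ cfZ mulf_eq0.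
  by rewrite (negbTE cr) => /eqP.
rewrite linearZ cfZ mulr_ge0 ?pv ?(subsetP IS) //.
by have /(mcrP w IS) := wI; apply.
Qed.

End Parabolic.

(** * Elements of W that permute simple roots, and pointwise stabilizers *)

Section SimpleMaps.
Variables (R : realType) (V : vectType R[i]) (form : {dot V for conjc}).
Variables (W : finGroupType) (rho : W -> 'End(V)) (S : {set W}) (alpha : W -> V).
Hypothesis HW : coxeter_reflection_group form rho S alpha.

Local Notation C := R[i].
Local Notation cf := (cf S alpha).
Local Notation pos := (pos S alpha).
Local Notation root := (root rho S alpha).
Local Notation in_span := (in_span S alpha).
Local Notation mcr := (min_coset_reps S).
Local Notation mrep := (mrep S).
Local Notation rhoM := (rhoM HW).

Lemma rho_conj w s v : s \in S ->
  rho (s ^ w^-1)%g v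
  = v - (2 * form v (rho w (alpha s))) *: rho w (alpha s).
Proof.
move=> sS; rewrite conjgE invgK !rhoM (rho_simple HW _ sS) raddfB /=.
rewrite (rhoKV HW) [rho w (_ *: _)]linearZ /= -(crg_form HW w).
by rewrite (rhoKV HW).
Qed.

(** An element of [W] that sends a simple root to a simple root conjugates the
    corresponding reflections, which are determined by their roots. *)
Lemma simple_conj w s t : s \in S -> t \in S ->
  rho w (alpha s) = alpha t -> (s ^ w^-1)%g = t.
Proof.
move=> sS tS st; apply: (rho_ext HW) => v.
by rewrite rho_conj // st (rho_simple HW).
Qed.

Lemma pos_conj w s t : s \in S -> t \in S -> (s ^ w^-1)%g = t ->
  pos (rho w (alpha s)) -> rho w (alpha s) = alpha t.
Proof.
move=> sS tS st pw; set b := rho w (alpha s) in pw *.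
have rb : root b by exists w, s.
have : rho (s ^ w^-1)%g b = - b.
  rewrite rho_conj // -/b (root_norm HW rb) mulr1 scaler_nat mulr2n.
  by rewrite opprD addrA subrr add0r.
rewrite st (rho_simple HW) // => bE.
have {}bE : b = form b (alpha t) *: alpha t.
  have /(congr1 (fun v => 2^-1 *: v)) : 2 *: b = (2 * form b (alpha t)) *: alpha t.
    by rewrite scaler_nat mulr2n -{2}[b]opprK -bE opprB addrC subrK.
  by rewrite !scalerA mulrA mulVf ?pnatr_eq0 // scale1r mul1r.
apply: (root_collinear HW) => // r rS rt.
by rewrite bE cfZ (cf_alpha HW) // eq_sym (negbTE rt) mulr0.
Qed.

(** [w (Delta_J) \subset Delta_I], where [w (alpha s)] can only be the simple root
    of [w s w^-1]. Having [I] as a parameter allows the same notion to be used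
    inside [W_I]. *)
Definition smap w (J I : {set W}) : bool :=
  [forall s in J, ((s ^ w^-1)%g \in I) && (rho w (alpha s) == alpha (s ^ w^-1)%g)].

Lemma smapP w (J I : {set W}) :
  reflect (forall s, s \in J ->
             (s ^ w^-1)%g \in I /\ rho w (alpha s) = alpha (s ^ w^-1)%g)
          (smap w J I).
Proof.
apply: (iffP forall_inP) => wJ s /wJ; first by case/andP=> -> /eqP.
by case=> -> ->; rewrite eqxx.
Qed.

Lemma smap_simple w (J I : {set W}) : J \subset S -> I \subset S ->
  (forall s, s \in J -> exists2 t, t \in I & rho w (alpha s) = alpha t) ->
  smap w J I.
Proof.
move=> JS IS wJ; apply/smapP => s sJ; have [t tI st] := wJ s sJ.
by rewrite (simple_conj (subsetP JS s sJ) (subsetP IS t tI) st).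
Qed.

Lemma maps_simpleE w (J : {set W}) : J \subset S ->
  maps_simple rho S alpha w J = smap w J S.
Proof.
move=> JS; apply/forall_inP/idP => [wJ|/smapP wJ s /wJ[tS st]].
  apply: smap_simple => // s /wJ/exists_inP[t tS /eqP st]; exists t; rewrite // st.
by apply/exists_inP; exists (s ^ w^-1)%g; rewrite ?st.
Qed.

Lemma mem_conjV (J : {set W}) w s : s \in J -> (s ^ w^-1)%g \in (J :^ w^-1)%g.
Proof. by rewrite memJ_conjg. Qed.

Lemma smap_conj_sub w (J I : {set W}) : smap w J I -> (J :^ w^-1)%g \subset I.
Proof.
by move/smapP => wJ; apply/subsetP => _ /imsetP[s sJ ->]; have [] := wJ s sJ.
Qed.

Lemma smap_subl w (J J' I : {set W}) : J' \subset J -> smap w J I -> smap w J' I.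
Proof. by move=> JJ /smapP wJ; apply/smapP => s /(subsetP JJ)/wJ. Qed.

Lemma smap_subr w (J I I' : {set W}) : I \subset I' -> smap w J I -> smap w J I'.
Proof.
by move=> II /smapP wJ; apply/smapP => s /wJ[/(subsetP II)].
Qed.

Lemma smap1 (J I : {set W}) : smap 1%g J I = (J \subset I).
Proof.
apply/smapP/subsetP => JI s /JI; first by case; rewrite invg1 conjg1.
by rewrite invg1 conjg1 (rho1 HW).
Qed.

Lemma smap_mcr w (J : {set W}) : J \subset S -> smap w J S -> w \in mcr J.
Proof.
move=> JS /smapP wJ; apply/(mcrP HW) => // s /wJ[sS ->]; exact: (pos_alpha HW).
Qed.

Lemma smapM v u (J I K : {set W}) : smap u J I ->
  smap (v * u)%g J K = smap v (J :^ u^-1)%g K.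
Proof.
move=> /smapP uJ; apply/smapP/smapP => [vuJ _ /imsetP[s sJ ->]|vJ s sJ].
  have [_ us] := uJ s sJ; have := vuJ s sJ.
  by rewrite rhoM us invMg conjgM.
have [_ us] := uJ s sJ; have := vJ _ (mem_conjV u sJ).
by rewrite rhoM us invMg conjgM.
Qed.

Lemma smapV w (J I : {set W}) : smap w J I -> smap w^-1%g (J :^ w^-1)%g J.
Proof.
move=> /smapP wJ; apply/smapP => _ /imsetP[s sJ ->].
have [_ <-] := wJ s sJ; rewrite invgK conjgKV; split=> //.
by rewrite (rhoK HW).
Qed.

(** The simple roots of [M] go to positive combinations of the simple roots of [I]
    under [u]; if [v] makes them simple they already were. *)
Lemma smap_parabolic (M I : {set W}) v u : M \subset I -> I \subset S ->
  v \in mcr I -> u \in <<I>>%g ->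
  smap (v * u)%g M S = smap u M I && smap v (M :^ u^-1)%g S.
Proof.
move=> MI IS vI uI; apply/idP/andP => [vu|[uM]]; last by rewrite (smapM v _ uM).
suff uM : smap u M I by split; rewrite // -(smapM _ _ uM).
have MS := subset_trans MI IS.
apply: smap_simple => // s sM.
have [sS vus] := smapP _ _ _ vu s sM.
have sp : in_span I (rho u (alpha s)).
  by apply/(rho_in_span HW)/(in_span_alpha HW)/(subsetP MI).
have rt : root (rho u (alpha s)).
  by apply/(root_rho HW)/(root_alpha HW)/(subsetP MS).
by apply: (mcr_simple HW IS vI sp rt sS); rewrite -rhoM.
Qed.

(** The inverse of [d] sends a simple root of [I] to the root of a reflection in
    [W_L], which lies in the span of the simple roots of [L]; as [d] belongs to
    [W^L], this root is simple. *)
Lemma mcr_conj_simple (I L : {set W}) d : I \subset S -> L \subset S ->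
  d \in mcr L -> (<<L>> :^ d^-1 = <<I>>)%g ->
  smap d L I /\ (L :^ d^-1)%g = I.
Proof.
move=> IS LS dL dLI.
have dI : smap d^-1%g I L.
  apply: smap_simple => // r rI; have rS := subsetP IS r rI.
  set b := rho d^-1%g (alpha r).
  have rb : root b by apply/(root_rho HW)/(root_alpha HW).
  have bL : in_span L b.
    have rdL : (r ^ d)%g \in <<L>>%g.
      by rewrite -(memJ_conjg _ d^-1) -conjgM mulgV conjg1 dLI mem_gen.
    have := rho_sub_span HW b LS rdL.
    rewrite -{1}[d]invgK rho_conj // -/b (root_norm HW rb) mulr1.
    rewrite addrAC subrr add0r -scaleNr => /(in_spanZ (- 2^-1)).
    by rewrite scalerA mulrNN mulVf ?pnatr_eq0 // scale1r.
  exact: (mcr_simple HW LS dL bL rb rS (rhoKV HW d _)).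
have sub : I \subset (L :^ d^-1)%g.
  by have := smap_conj_sub dI; rewrite invgK sub_conjg.
have dId : (I :^ d = L)%g.
  have dmI : d^-1%g \in mcr I.
    by apply: smap_mcr => //; apply: smap_subr dI.
  apply/eqP; rewrite eqEcard; have := smap_conj_sub dI; rewrite invgK => -> /=.
  rewrite cardJg.
  have : smap d L I.
    apply: smap_simple => // s sL; have sS := subsetP LS s sL.
    set b := rho d (alpha s).
    have rb : root b by apply/(root_rho HW)/(root_alpha HW).
    have bI : in_span I b.
      have sdI : (s ^ d^-1)%g \in <<I>>%g.
        by rewrite -dLI memJ_conjg mem_gen.
      have := rho_sub_span HW b IS sdI.
      rewrite rho_conj // -/b (root_norm HW rb) mulr1.
      rewrite addrAC subrr add0r -scaleNr => /(in_spanZ (- 2^-1)).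
      by rewrite scalerA mulrNN mulVf ?pnatr_eq0 // scale1r.
    exact: (mcr_simple HW IS dmI bI rb sS (rhoK HW d _)).
  by move=> /smap_conj_sub/subset_leq_card; rewrite cardJg.
have LdI : (L :^ d^-1)%g = I by rewrite -dId conjsgK.
by have := smapV dI; rewrite !invgK dId; split.
Qed.

(** The shortest element of [n W_L] normalizes [W_L] as well, so that
    [mcr_conj_simple] applies to it with [I = L]. *)
Lemma normaliser_parabolic (L : {set W}) n : L \subset S ->
  n \in 'N(<<L>>)%g ->
  let d := mrep L n in
  [/\ smap d L L, (L :^ d^-1)%g = L & (d^-1 * n)%g \in <<L>>%g].
Proof.
move=> LS nN d; have [dL dn] := mrepP HW n LS; rewrite -/d in dL dn.
have dN : d \in 'N(<<L>>)%g.
  by rewrite -(groupMr _ (subsetP (normG _) _ dn)) mulKVg.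
have dE : (<<L>> :^ d^-1 = <<L>>)%g by apply: (normP _); rewrite groupV.
by have [] := mcr_conj_simple LS LS dL dE.
Qed.

Definition span_simple (I : {set W}) : {vspace V} := (\sum_(s in I) <[alpha s]>)%VS.

Lemma X_orthov (I : {set W}) : I \subset S ->
  X_ rho I = orthov form (span_simple I).
Proof.
move=> IS; apply/eqP; rewrite eqEsubv; apply/andP; split.
  rewrite orthov_sym; apply/subv_sumP => s sI.
  rewrite orthov_sym -(crg_hyperplane HW) ?(subsetP IS) //.
  exact: (bigcapv_inf s sI (subvv _)).
apply/subv_bigcapP => s sI; rewrite (crg_hyperplane HW) ?(subsetP IS) //.
rewrite orthov_sym; apply: subv_trans (_ : (span_simple I <= _)%VS).
  exact: (sumv_sup s).
by rewrite orthov_sym.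
Qed.

Lemma span_simpleP (I : {set W}) v : I \subset S ->
  v \in span_simple I -> in_span I v.
Proof.
move=> IS /memv_sumP[c cI ->].
have -> : \sum_(s in I) c s = \sum_(s in I) cf s (c s) *: alpha s.
  apply: eq_bigr => s sI; have /vlineP[k ->] := cI s sI.
  by rewrite cfZ (cf_alpha HW) ?(subsetP IS) // eqxx mulr1.
exact: (in_spanP HW).
Qed.

Lemma pstabP (X : {vspace V}) w : reflect {in X, rho w =1 id} (w \in pstab rho X).
Proof. by rewrite inE; apply: fixedSpacesP. Qed.

Lemma pstab_group_set X : group_set (pstab rho X).
Proof.
apply/group_setP; split=> [|u w /pstabP uX /pstabP wX].
  by apply/pstabP => v _; rewrite (rho1 HW).
by apply/pstabP => v vX; rewrite rhoM wX ?uX.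
Qed.
Canonical pstab_group X := Group (pstab_group_set X).

(** An element of [W^I] that fixes [X_I] pointwise sends every simple root to a
    positive one: outside [I], a root only changes by a vector in the span of the
    simple roots of [I]. Hence it is [1]. *)
Lemma pstab_X (I : {set W}) : I \subset S -> pstab rho (X_ rho I) = <<I>>%g.
Proof.
move=> IS; have sub : <<I>>%g \subset pstab rho (X_ rho I).
  rewrite gen_subG; apply/subsetP => s sI; rewrite inE.
  exact: (bigcapv_inf s sI (subvv _)).
apply/eqP; rewrite finset.eqEsubset sub andbT; apply/subsetP => w wX.
have [dI dw] := mrepP HW w IS; set d := mrep I w in dI dw.
have dX : d \in pstab rho (X_ rho I).
  by rewrite -(groupMr _ (subsetP sub _ dw)) mulKVg.
suff d1 : d = 1%g by rewrite d1 invg1 mul1g in dw.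
apply: (mcrS HW); apply/(mcrP HW) => // s sS.
have [sI|sI] := boolP (s \in I); first by have /(mcrP HW _ IS) := dI; apply.
have sp : in_span I (rho d (alpha s) - alpha s).
  apply: span_simpleP => //; rewrite -(orthovK form (span_simple I)) -X_orthov //.
  apply/mem_orthovP => x xX; rewrite -[LHS]/(form _ _) formBl.
  by rewrite -{1}(pstabP _ _ dX x xX) (crg_form HW) subrr.
have c1 : cf s (rho d (alpha s)) = 1.
  apply/eqP; rewrite -subr_eq0 -{1}[1]/(true%:R) -(eqxx s) -(cf_alpha HW) //.
  by rewrite -raddfB /= (in_span_cf0 HW IS sI sp).
have [//|/(_ s sS)] := root_pos_neg HW (root_rho HW d (root_alpha HW sS)).
by rewrite raddfN /= c1 oppr_ge0 ler10.
Qed.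

Lemma pstab_img X w : pstab rho (rho w @: X)%VS = (pstab rho X :^ w^-1)%g.
Proof.
apply/setP => u; rewrite mem_conjgV.
apply/pstabP/pstabP => uX x xX.
  apply: (rho_inj HW (w := w)); rewrite -rhoM mulKVg rhoM.
  by apply/uX/memv_img.
have /memv_imgP[y yX ->] := xX.
by have := uX y yX; rewrite conjgE !rhoM => {2}<-; rewrite (rhoKV HW).
Qed.

Lemma img_rhoM u w X : (rho (u * w)%g @: X)%VS = (rho u @: (rho w @: X))%VS.
Proof. by rewrite (crg_rhoM HW) limg_comp. Qed.

Lemma img_rho1 X : (rho 1%g @: X)%VS = X.
Proof. by rewrite (crg_rho1 HW) lim1g. Qed.

Lemma orbit_sym lambda X Y : lattice_orbits rho lambda ->
  lambda X -> lambda Y -> exists w, Y = (rho w @: X)%VS.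
Proof.
move=> [Z _ <-] [u _ <-] [w _ <-]; exists (w * u^-1)%g.
by rewrite -img_rhoM mulgKV.
Qed.

Lemma same_orbit_simple lambda (I L : {set W}) : lattice_orbits rho lambda ->
  I \in S_ rho S lambda -> L \in S_ rho S lambda ->
  exists d, smap d L I /\ (L :^ d^-1)%g = I.
Proof.
move=> lam; rewrite !inE => /andP[IS /set_mem XI] /andP[LS /set_mem XL].
have [w wE] := orbit_sym lam XL XI.
have : pstab rho (X_ rho I) = pstab rho (rho w @: X_ rho L)%VS by rewrite -wE.
rewrite pstab_img !pstab_X // => IL; have [dL dw] := mrepP HW w LS.
exists (mrep L w); apply: mcr_conj_simple => //.
rewrite IL -[in RHS](mulKVg (mrep L w) w) invMg conjsgM.
by congr (_ :^ _)%g; rewrite conjGid ?groupV.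
Qed.

End SimpleMaps.

(** * Truncations in a group algebra *)

Section GroupAlgebraTheory.
Variables (K : fieldType) (G : finGroupType).
Implicit Types (u v : galg K G) (g h : G).

Lemma galgE u : u = \sum_g u g *: gelt K g.
Proof.
apply/ffunP => x; rewrite sum_ffunE (bigD1 x) //= big1 => [|g gx].
  by rewrite !ffunE eqxx addr0 [_ *: _]mulr1.
by rewrite !ffunE eq_sym (negbTE gx) scaler0.
Qed.

Lemma geltM g h : gelt K (g * h)%g = gelt K g * gelt K h.
Proof.
apply/ffunP => x; rewrite !ffunE (bigD1 g) //= big1 => [|y yg].
  by rewrite !ffunE eqxx mul1r addr0 -(inj_eq (mulgI g^-1%g)) mulKg.
by rewrite !ffunE (negbTE yg) mul0r.
Qed.

Lemma gelt1 : gelt K (1%g : G) = 1.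
Proof. by []. Qed.

(** Truncation of an element of [K G] to a subset of [G]; the elements of the
    group algebra of a subgroup [H] are the fixed points of [gres H]. *)
Definition gres (H : {set G}) u : galg K G := [ffun g => if g \in H then u g else 0].

Fact gres_linear H : linear (gres H).
Proof.
move=> k u v; apply/ffunP => g; rewrite !ffunE.
by case: ifP => // _; rewrite scaler0 addr0.
Qed.
HB.instance Definition _ H :=
  GRing.isLinear.Build K (galg K G) (galg K G) *:%R (gres H) (gres_linear H).

Lemma gresZ H k u : gres H (k *: u) = k *: gres H u.
Proof. by rewrite linearZ. Qed.

Lemma gresD H u v : gres H (u + v) = gres H u + gres H v.
Proof. by rewrite linearD. Qed.

Lemma gresB H u v : gres H (u - v) = gres H u - gres H v.
Proof. by rewrite linearB. Qed.

Lemma gres_sum H (I : Type) (r : seq I) (P : pred I) (F : I -> galg K G) :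
  gres H (\sum_(i <- r | P i) F i) = \sum_(i <- r | P i) gres H (F i).
Proof. by rewrite linear_sum. Qed.

Lemma gres_gelt H g : gres H (gelt K g) = if g \in H then gelt K g else 0.
Proof.
apply/ffunP => x; rewrite ffunE; case: ifP => xH; case: ifP => gH;
  rewrite !ffunE //; case: eqP => // xg; by rewrite -xg xH in gH.
Qed.

Lemma gresT u : gres [set: G] u = u.
Proof. by apply/ffunP => g; rewrite ffunE finset.in_setT. Qed.

Lemma gres_id H u : gres H (gres H u) = gres H u.
Proof. by apply/ffunP => g; rewrite !ffunE; case: (g \in H). Qed.

Lemma gres_sub (H H' : {set G}) u : H \subset H' -> gres H u = u -> gres H' u = u.
Proof.
move=> HH <-; apply/ffunP => g; rewrite !ffunE; case: ifP => //.
by case: ifP => // /(subsetP HH) ->.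
Qed.

Lemma gresE H u : gres H u = \sum_(g in H) u g *: gelt K g.
Proof.
rewrite {1}(galgE u) linear_sum [RHS]big_mkcond /=; apply: eq_bigr => g _.
by rewrite linearZ /= gres_gelt; case: ifP => // _; rewrite scaler0.
Qed.

Lemma gres_mulr (H : {group G}) u v :
  gres H v = v -> gres H (u * v) = gres H u * v.
Proof.
move=> <-; rewrite [gres H v]gresE !mulr_sumr linear_sum /=.
apply: eq_bigr => h hH; rewrite -!scalerAr linearZ /=; congr (_ *: _).
rewrite (galgE u) linear_sum !mulr_suml linear_sum /=; apply: eq_bigr => g _.
rewrite linearZ -!scalerAl linearZ /= -geltM !gres_gelt groupMr //.
by case: ifP => // _; rewrite ?geltM ?mul0r.
Qed.

Lemma gres_mull (H : {group G}) u v :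
  gres H u = u -> gres H (u * v) = u * gres H v.
Proof.
move=> <-; rewrite [gres H u]gresE !mulr_suml linear_sum /=.
apply: eq_bigr => h hH; rewrite -!scalerAl linearZ /=; congr (_ *: _).
rewrite (galgE v) linear_sum !mulr_sumr linear_sum /=; apply: eq_bigr => g _.
rewrite linearZ -!scalerAr linearZ /= -geltM !gres_gelt groupMl //.
by case: ifP => // _; rewrite ?geltM ?mulr0.
Qed.

Lemma gresM (H : {group G}) u v :
  gres H u = u -> gres H v = v -> gres H (u * v) = u * v.
Proof. by move=> uH vH; rewrite gres_mull // vH. Qed.

Lemma gres_geltP (H : {set G}) g : g \in H -> gres H (gelt K g) = gelt K g.
Proof. by move=> gH; rewrite gres_gelt gH. Qed.

Lemma mem_galg_of (H : {set G}) u : reflect (gres H u = u) (u \in galg_of K H).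
Proof.
apply: (iffP idP) => [|<-]; last first.
  rewrite gresE; apply: rpred_sum => g gH; apply: rpredZ; apply: memv_span.
  by apply/mapP; exists g; rewrite ?mem_enum.
move/coord_span => ->; rewrite linear_sum; apply: eq_bigr => i _.
rewrite linearZ; congr (_ *: _).
have : [seq gelt K h | h in H]`_i \in [seq gelt K h | h in H].
  by rewrite mem_nth // size_tuple.
by case/mapP => g; rewrite mem_enum => gH ->; apply: gres_geltP.
Qed.

Lemma gres_conj (H : {group G}) u n : n \in 'N(H)%g -> gres H u = u ->
  gres H (gelt K n^-1%g * u * gelt K n) = gelt K n^-1%g * u * gelt K n.
Proof.
move=> nN <-; rewrite [gres H u]gresE mulr_sumr mulr_suml linear_sum /=.
apply: eq_bigr => h hH; rewrite -scalerAr -scalerAl linearZ /= -!geltM.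
by rewrite gres_geltP // -mulgA -conjgE memJ_norm.
Qed.

End GroupAlgebraTheory.

(** * Sums over coset representatives *)

Section CosetSums.
Variables (R : realType) (V : vectType R[i]) (form : {dot V for conjc}).
Variables (W : finGroupType) (rho : W -> 'End(V)) (S : {set W}) (alpha : W -> V).
Hypothesis HW : coxeter_reflection_group form rho S alpha.

Local Notation C := R[i].
Local Notation cf := (cf S alpha).
Local Notation pos := (pos S alpha).
Local Notation root := (root rho S alpha).
Local Notation in_span := (in_span S alpha).
Local Notation mcr := (min_coset_reps S).
Local Notation mrep := (mrep S).
Local Notation smap := (smap rho alpha).
Local Notation rhoM := (rhoM HW).
Local Notation gelt := (gelt C).
Local Notation x_ := (x_ R S).

(** Each element of [W] factors uniquely over [W^I] and [W_I]. *)
Lemma big_mcr (Z : nmodType) (I : {set W}) (P : pred W) (F : W -> Z) : I \subset S ->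
  \sum_(w | P w) F w
  = \sum_(v in mcr I) \sum_(u in <<I>>%g | P (v * u)%g) F (v * u)%g.
Proof.
move=> IS; rewrite pair_big_dep /=.
rewrite (reindex_onto (fun p : W * W => (p.1 * p.2)%g)
  (fun w => (mrep I w, ((mrep I w)^-1 * w)%g))) /=; last first.
  by move=> w _; rewrite mulKVg.
apply: eq_bigl => -[v u] /=; apply/andP/andP => [[Pvu /eqP[vE uE]]|[vI]].
  have [] := mrepP HW (v * u)%g IS; rewrite uE vE => vI uI.
  by rewrite vI uI Pvu.
by case/andP => uI Pvu; rewrite Pvu (mrep_eq HW) // mulKg eqxx.
Qed.

Lemma big_mcrV (Z : nmodType) (I : {set W}) (P : pred W) (F : W -> Z) : I \subset S ->
  \sum_(w | P w) F w
  = \sum_(d | d^-1%g \in mcr I) \sum_(u in <<I>>%g | P (u * d)%g) F (u * d)%g.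
Proof.
move=> IS; rewrite (reindex_inj invg_inj) (big_mcr _ _ IS) /=.
rewrite [LHS](reindex_inj invg_inj) /=; apply: eq_bigr => d dI.
rewrite (reindex_inj invg_inj) /=; apply: eq_big => u.
  by rewrite groupV -invMg invgK.
by rewrite -invMg invgK.
Qed.

(** For [s] in [J], either [d (alpha s)] is outside the span of the simple roots
    of [K], and [a] preserves its sign, or it is a simple root of [K], by
    indecomposability, and then [d s d^-1] belongs to [K]. *)
Lemma mcr_double (K J : {set W}) d a : K \subset S -> J \subset S ->
  d^-1%g \in mcr K -> a \in <<K>>%g ->
  ((a * d)%g \in mcr J)
  = (d \in mcr J) && (a \in mcr (K :&: J :^ d^-1)%g).
Proof.
move=> KS JS dK aK; have KJS : (K :&: J :^ d^-1)%g \subset S.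
  exact: subset_trans (subsetIl _ _) KS.
have rt s : s \in J -> root (rho d (alpha s)).
  by move=> sJ; apply/(root_rho HW)/(root_alpha HW)/(subsetP JS).
apply/(mcrP HW _ JS)/andP => [adJ|[/(mcrP HW _ JS) dJ aKJ] s sJ].
  have dJ s : s \in J -> pos (rho d (alpha s)).
    move=> sJ; have sS := subsetP JS s sJ.
    have [//|nb] := root_pos_neg HW (rt s sJ); exfalso.
    have [sp|nsp] := pselect (in_span K (- rho d (alpha s))).
      have := mcr_pos HW KS dK sp nb.
      rewrite raddfN /= (rhoK HW) => ns.
      exact: (root_posN HW (root_alpha HW sS) (pos_alpha HW sS) ns).
    have := pos_notin_span HW KS aK (rootN HW (rt s sJ)) nb nsp.
    rewrite raddfN /= -rhoM; apply: (root_posN HW) (adJ s sJ).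
    exact/(root_rho HW)/(root_alpha HW).
  split; first exact/(mcrP HW).
  apply/(mcrP HW) => // r /setIP[rK /imsetP[s sJ rE]]; have sS := subsetP JS s sJ.
  rewrite rE -(pos_conj HW sS _ (erefl _) (dJ s sJ)) -?rE ?(subsetP KS) //.
  by rewrite -rhoM; apply: adJ.
rewrite rhoM; have sS := subsetP JS s sJ.
have [sp|nsp] := pselect (in_span K (rho d (alpha s))); last first.
  exact: (pos_notin_span HW KS aK (rt s sJ) (dJ s sJ) nsp).
have [r rK dr] := mcr_simple HW KS dK sp (rt s sJ) sS (rhoK HW _ _).
have rS := subsetP KS r rK; rewrite dr; move/(mcrP HW _ KJS): aKJ; apply.
by rewrite inE rK -(simple_conj HW sS rS dr) memJ_conjg.
Qed.

Lemma smapVE (K J : {set W}) d : K \subset S -> J \subset S -> d \in mcr J ->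
  smap d^-1%g K J = (d^-1%g \in mcr K) && (K \subset (J :^ d^-1)%g).
Proof.
move=> KS JS dJ; apply/idP/andP => [dK|[dK /subsetP KJ]].
  split; first by apply: (smap_mcr HW) => //; apply: smap_subr dK.
  by have := smap_conj_sub dK; rewrite invgK sub_conjg.
apply: (smap_simple HW) => // r rK; have /imsetP[s sJ rE] := KJ r rK.
exists s => //; apply: (rho_inj HW (w := d)); rewrite (rhoKV HW).
have rS := subsetP KS r rK.
apply/esym; apply: (pos_conj HW) => //; first exact: (subsetP JS).
by move/(mcrP HW _ JS): dJ; apply.
Qed.

Lemma mcr_conj (K : {set W}) d w : K \subset S -> smap d K S ->
  (w \in mcr (K :^ d^-1)%g) = ((w * d)%g \in mcr K).
Proof.
move=> KS dK; have dKS := smap_conj_sub dK.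
apply/(mcrP HW _ dKS)/(mcrP HW _ KS) => wK s; last first.
  case/imsetP => r rK ->; have [_ <-] := smapP _ _ _ _ _ dK r rK.
  by rewrite -rhoM; apply: wK.
move=> sK; have [_ ds] := smapP _ _ _ _ _ dK s sK.
by rewrite rhoM ds; apply: wK; rewrite memJ_conjg.
Qed.

Lemma x_conj (K : {set W}) d : K \subset S -> smap d K S ->
  x_ (K :^ d^-1)%g * gelt d = x_ K.
Proof.
move=> KS dK; rewrite /Defs.x_ mulr_suml [RHS](reindex_inj (mulIg d)) /=.
by apply: eq_big => w; rewrite ?mcr_conj // geltM.
Qed.

Lemma gres_x (I K : {set W}) : gres <<I>>%g (x_ K)
  = \sum_(u in <<I>>%g | u \in mcr K) gelt u.
Proof.
rewrite linear_sum /= big_andbC /= [RHS]big_mkcondr /=.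
by apply: eq_bigr => u _; rewrite gres_gelt.
Qed.

Lemma gres_x1 (I : {set W}) : I \subset S -> gres <<I>>%g (x_ I) = 1.
Proof.
move=> IS; rewrite gres_x (big_pred1 1%g) ?gelt1 // => u /=.
apply/andP/eqP => [[uI uI']|->]; first exact: (mcr_parabolic1 HW IS uI uI').
by rewrite group1 (mcr1 HW).
Qed.

(** This is the factorization [W^K = W^I (W_I :&: W^K)]. *)
Lemma x_factor (I K : {set W}) : K \subset I -> I \subset S ->
  x_ K = x_ I * gres <<I>>%g (x_ K).
Proof.
move=> KI IS; rewrite [LHS](big_mcr _ _ IS) /= gres_x mulr_suml.
apply: eq_bigr => v vI; rewrite mulr_sumr.
apply: eq_big => [u|u _]; last by rewrite geltM.
by case uI: (u \in _); rewrite //= (mcrM HW KI IS vI uI).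
Qed.

End CosetSums.

(** * The elements e_I of the descent algebra *)

Section DescentAlgebra.
Variables (R : realType) (V : vectType R[i]) (form : {dot V for conjc}).
Variables (W : finGroupType) (rho : W -> 'End(V)) (S : {set W}) (alpha : W -> V).
Hypothesis HW : coxeter_reflection_group form rho S alpha.
Variable sigma : {set W} -> R.
Hypothesis sigma_gt0 : forall I : {set W}, I \subset S -> 0 < sigma I.
Variable e : {set W} -> galg R[i] W.
Hypothesis He : e_system rho S alpha sigma e.

Local Notation C := R[i].
Local Notation mcr := (min_coset_reps S).
Local Notation smap := (smap rho alpha).
Local Notation gelt := (gelt C).
Local Notation x_ := (x_ R S).
Local Notation m_ := (m_ rho S alpha sigma).

Lemma m_E (J K : {set W}) : J \subset K -> K \subset S ->
  m_ J K = \sum_(w in mcr K | smap w J S) sigma (J :^ w^-1)%g.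
Proof.
move=> JK KS; rewrite /m_ JK; apply: eq_bigl => w.
by rewrite (maps_simpleE HW) // (subset_trans JK).
Qed.

Lemma m_gt0 (K : {set W}) : K \subset S -> 0 < m_ K K.
Proof.
move=> KS; rewrite m_E // (bigD1 1%g) /=; last first.
  by rewrite (mcr1 HW) // (smap1 HW).
rewrite ltr_pwDl // ?sigma_gt0 //; first by rewrite invg1 conjsg1.
apply: sumr_ge0 => w /andP[/andP[_ wK] _].
by rewrite ltW // sigma_gt0 // (smap_conj_sub wK).
Qed.

Lemma m_neq0 (K : {set W}) : K \subset S -> (m_ K K)%:C != 0 :> C.
Proof. by move=> KS; rewrite gt_eqF // ltcR m_gt0. Qed.

Lemma x_sub (K : {set W}) : K \subset S ->
  x_ K = \sum_(J : {set W} | J \subset K) (m_ J K)%:C *: e J.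
Proof.
move=> KS; rewrite He // [RHS]big_mkcond [LHS]big_mkcond /=.
apply: eq_bigr => J _; case: ifP => JS; case: ifP => JK //.
  by rewrite /m_ JK scale0r.
by rewrite (subset_trans JK KS) in JS.
Qed.

Lemma x_proper (K : {set W}) : K \subset S ->
  x_ K = (m_ K K)%:C *: e K
         + \sum_(J : {set W} | J \proper K) (m_ J K)%:C *: e J.
Proof.
move=> KS; rewrite x_sub // (bigD1 K) //=; congr (_ + _).
by apply: eq_bigl => J; rewrite finset.properEneq andbC.
Qed.

Lemma e_proper (K : {set W}) : K \subset S ->
  e K = ((m_ K K)%:C)^-1 *:
    (x_ K - \sum_(J : {set W} | J \proper K) (m_ J K)%:C *: e J).
Proof.
by move=> KS; rewrite x_proper // addrK scalerA mulVf ?scale1r // m_neq0.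
Qed.

(** [f K] is the counterpart of [e K] inside the group algebra of [W_K]. *)
Local Notation f K := (gres <<K>>%g (e K)).

(** The corresponding property of [x_K] is [x_factor]; it passes to [e_K] since the
    matrix of the [m_ J K] is triangular. *)
Lemma e_factor (I K : {set W}) : K \subset I -> I \subset S ->
  e K = x_ I * gres <<I>>%g (e K).
Proof.
move=> + IS; move: {2}#|K|.+1 (ltnSn #|K|) => n; elim: n K => // n IH K Kn KI.
have KS := subset_trans KI IS.
have EK := e_proper KS; rewrite [in RHS]EK gresZ -scalerAr gresB mulrBr {1}EK.
congr (_ *: (_ - _)); first exact: (x_factor HW).
rewrite gres_sum mulr_sumr; apply: eq_bigr => J JK.
rewrite gresZ -scalerAr -IH // ?(subset_trans (proper_sub JK)) //.
exact: leq_trans (proper_card JK) _.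
Qed.

Lemma gres_e (I K : {set W}) : K \subset I -> I \subset S ->
  gres <<I>>%g (e K) = gres <<I>>%g (x_ K) * f K.
Proof.
move=> KI IS; rewrite {1}(e_factor (subxx K)) ?(subset_trans KI) //.
by rewrite gres_mulr //; apply: gres_sub (gres_id _ _); apply: genS.
Qed.

Lemma m_conj (J K : {set W}) d : J \subset K -> K \subset S -> smap d K S ->
  m_ (J :^ d^-1)%g (K :^ d^-1)%g = m_ J K.
Proof.
move=> JK KS dK; have dKS := smap_conj_sub dK.
rewrite !m_E ?conjSg // [RHS](reindex_inj (mulIg d)) /=.
have dJ := smap_subl JK dK.
apply: eq_big => w; first by rewrite (mcr_conj HW) // (smapM HW _ _ dJ).
by rewrite invMg conjsgM.
Qed.

(** Right multiplication by [d] transports [x_K] and the coefficients [m_ J K]. *)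
Lemma e_conj (K : {set W}) d : K \subset S -> smap d K S ->
  e (K :^ d^-1)%g * gelt d = e K.
Proof.
move: {2}#|K|.+1 (ltnSn #|K|) => n; elim: n K => // n IH K Kn KS dK.
have dKS := smap_conj_sub dK.
rewrite e_proper // -scalerAl mulrBl (x_conj HW) // m_conj //.
rewrite [RHS](e_proper KS).
congr (_ *: (_ - _)).
rewrite mulr_suml.
rewrite (reindex_inj (@conjsg_inj _ d^-1%g)) /=; apply: eq_big => [J|J JK].
  by rewrite properJ.
have {}JK : J \proper K by rewrite -(properJ _ _ d^-1%g).
have JK' := proper_sub JK.
rewrite -scalerAl m_conj // IH ?(subset_trans JK') //.
  exact: leq_trans (proper_card JK) _.
exact: smap_subl dK.
Qed.

(** Factor the elements of [W^J] over [W^I] and [W_I]. The meaning of the identity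
    is that the weight [m_ - I] on the subsets of [I] gives rise in [W_I] to the
    same coefficients as [sigma] does in [W]. *)
Lemma m_trans (M J I : {set W}) : M \subset J -> J \subset I -> I \subset S ->
  m_ M J = \sum_(d in <<I>>%g | (d \in mcr J) && smap d M I) m_ (M :^ d^-1)%g I.
Proof.
move=> MJ JI IS; have JS := subset_trans JI IS.
have MI := subset_trans MJ JI.
rewrite m_E // (big_mcr HW _ _ IS) /=.
transitivity (\sum_(d in <<I>>%g | (d \in mcr J) && smap d M I)
  \sum_(v in mcr I | smap v (M :^ d^-1)%g S) sigma ((M :^ d^-1) :^ v^-1)%g).
  rewrite [RHS](exchange_big_dep (mem (mcr I))) /=; last by move=> d v _ /andP[].
  apply: eq_bigr => v vI; apply: eq_big => [d|d _]; last first.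
    by rewrite invMg conjsgM.
  case dI: (d \in _) => //=; rewrite vI (mcrM HW JI IS vI dI).
  by rewrite (smap_parabolic HW MI IS vI dI) andbA.
apply: eq_bigr => d /and3P[_ _ dM].
by rewrite m_E // (smap_conj_sub dM).
Qed.

(** Split the representatives in [x_J] along the cosets [W_K d]. The part in such
    a coset is [gres <<K>> (x_ M) * d], where [M] is the intersection of [K] and
    [d J d^-1], and it is killed by [f_K] unless [M = K]. *)
Lemma f_mul_x (K J I : {set W}) : K \subset I -> J \subset I -> I \subset S ->
  (forall M : {set W}, M \proper K -> f K * gres <<K>>%g (x_ M) = 0) ->
  f K * gres <<I>>%g (x_ J)
  = \sum_(d in <<I>>%g | (d \in mcr J) && smap d^-1%g K J) f K * gelt d.
Proof.
move=> KI JI IS f0; have KS := subset_trans KI IS; have JS := subset_trans JI IS.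
rewrite gres_x (big_mcrV HW _ _ KS) /= mulr_sumr.
rewrite big_mkcond [RHS]big_mkcond /=; apply: eq_bigr => d _.
have [dK|dK] := boolP (d^-1%g \in mcr K); last first.
  case: ifP => // /and3P[_ dJ]; rewrite (smapVE HW) // => /andP[].
  by rewrite (negbTE dK).
rewrite andbA; case: (boolP (_ && (d \in mcr J))) => [/andP[dI dJ]|dN]; last first.
  rewrite big1 ?mulr0 // => a /andP[aK /andP[adI adJ]]; case/negP: dN.
  rewrite (mcr_double HW KS JS dK aK) in adJ; case/andP: adJ => -> _.
  by rewrite andbT -(groupMl _ (subsetP (genS KI) _ aK)).
have -> : \sum_(u in <<K>>%g | ((u * d)%g \in <<I>>%g) && ((u * d)%g \in mcr J))
    gelt (u * d)%g = gres <<K>>%g (x_ (K :&: J :^ d^-1)%g) * gelt d.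
  rewrite gres_x mulr_suml; apply: eq_big => [a|a _]; last by rewrite geltM.
  case aK: (a \in _) => //=; rewrite (mcr_double HW KS JS dK aK) dJ /=.
  by rewrite groupMl ?dI //; apply: (subsetP (genS KI)).
rewrite mulrA /= (smapVE HW) // dK /=.
case: ifP => KJ; first by rewrite (finset.setIidPl KJ) (gres_x1 HW) // mulr1.
rewrite f0 ?mul0r // properE finset.subsetIl /= finset.subsetI subxx /=.
by rewrite KJ.
Qed.

Lemma smapV_eq (K J : {set W}) d :
  smap d^-1%g K J = smap d (K :^ d)%g K && ((K :^ d)%g \subset J).
Proof.
apply/idP/andP => [dK|[dK KJ]].
  by have := smapV HW dK; have := smap_conj_sub dK; rewrite !invgK.
by have := smapV HW dK; rewrite conjsgK; apply: smap_subr.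
Qed.

(** Inside [W_I], expand [x_I = 1] in the [e_K] and multiply by [x_J]. The terms
    with [K] smaller than [I] are known by induction, and add up to the expansion
    of [x_J]; hence the term of [f_I] vanishes. *)
Lemma f_kill (I J : {set W}) : I \subset S -> J \proper I ->
  f I * gres <<I>>%g (x_ J) = 0.
Proof.
move: {2}#|I|.+1 (ltnSn #|I|) => n; elim: n I J => // n IH I J In IS JI.
have JI' := proper_sub JI; have JS := subset_trans JI' IS.
set X := gres _ (x_ J).
have oneE : 1 = (m_ I I)%:C *: f I
    + \sum_(K : {set W} | K \proper I) (m_ K I)%:C *: gres <<I>>%g (e K).
  rewrite -(gres_x1 HW IS) x_proper // gresD gresZ gres_sum.
  by congr (_ + _); apply: eq_bigr => K _; rewrite gresZ.
suff XE : \sum_(K : {set W} | K \proper I) (m_ K I)%:C *: (gres <<I>>%g (e K) * X) = X.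
  have := congr1 (fun u => u * X) oneE; rewrite mul1r mulrDl -scalerAl mulr_suml.
  under [X in _ = _ + X]eq_bigr => K _ do rewrite -scalerAl.
  rewrite XE -{1}[X]add0r => /addIr/esym/eqP; rewrite scaler_eq0.
  by rewrite (negbTE (m_neq0 IS)) => /eqP.
(* [e_K = x_K f_K] in [W_I], and the case of [K] turns [f_mul_x] into a formula
   for [f_K x_J]. *)
have step (K : {set W}) : K \proper I -> gres <<I>>%g (e K) * X
    = \sum_(d in <<I>>%g | (d \in mcr J) && smap d^-1%g K J)
        gres <<I>>%g (e (K :^ d)%g).
  move=> KI; have KI' := proper_sub KI; have KS := subset_trans KI' IS.
  rewrite gres_e // -mulrA f_mul_x //; last first.
    by move=> M MK; apply: IH => //; apply: leq_trans (proper_card KI) _.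
  rewrite mulr_sumr; apply: eq_bigr => d /and3P[dI _ dK].
  rewrite mulrA -gres_e // -gres_mulr; last exact: gres_geltP.
  congr (gres _ _); have := e_conj (d := d^-1%g) KS; rewrite invgK => <-.
    by rewrite -mulrA -geltM mulVg gelt1 mulr1.
  exact: smap_subr dK.
under eq_bigr => K KI do rewrite step // scaler_sumr.
rewrite (exchange_big_dep (fun d => (d \in <<I>>%g) && (d \in mcr J))) /=; last first.
  by move=> K d _ /and3P[-> ->].
have -> : X = \sum_(M : {set W} | M \subset J)
    \sum_(d in <<I>>%g | (d \in mcr J) && smap d M I)
      (m_ (M :^ d^-1)%g I)%:C *: gres <<I>>%g (e M).
  rewrite /X x_sub // gres_sum; apply: eq_bigr => M MJ.
  by rewrite gresZ (m_trans MJ JI' IS) rmorph_sum scaler_suml.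
rewrite [RHS](exchange_big_dep (fun d => (d \in <<I>>%g) && (d \in mcr J))) /=;
  last by move=> K d _ /and3P[-> ->].
apply: eq_bigr => d /andP[dI dJ].
rewrite (reindex_inj (@conjsg_inj _ d^-1%g)) /=; apply: eq_big => [M|M _]; last first.
  by rewrite conjsgKV.
rewrite dI dJ /=.
have -> : smap d^-1%g (M :^ d^-1)%g J = smap d M (M :^ d^-1)%g && (M \subset J).
  by rewrite smapV_eq conjsgKV.
apply/andP/andP => [[MI /andP[dM MJ]]|[MJ dM]].
  by split=> //; apply: smap_subr dM; apply: proper_sub.
split; last first.
  by rewrite MJ andbT; have := smapV HW (smapV HW dM); rewrite invgK conjsgKV.
rewrite properEcard (smap_conj_sub dM) /= cardJg.
exact: leq_ltn_trans (subset_leq_card MJ) (proper_card JI).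
Qed.

End DescentAlgebra.

(** * The right ideals e_L C W *)

Lemma mem_line_prodv (K : fieldType) (aT : falgType K) (U : {vspace aT}) (v w : aT) :
  reflect (exists2 u, u \in U & w = v * u) (w \in (<[v]> * U)%VS).
Proof.
apply: (iffP idP) => [|[u uU ->]]; last exact: memv_mul (memv_line v) uU.
have /subvP sub : (<[v]> * U <= (amull v @: U))%VS.
  apply/prodvP => _ u /vlineP[k ->] uU; rewrite -scalerAl scalerAr.
  by have := memv_img (amull v) (memvZ k uU); rewrite lfunE.
by move/sub/memv_imgP => [u uU ->]; exists u; rewrite ?lfunE.
Qed.

Section OrbitModule.
Variables (R : realType) (V : vectType R[i]) (form : {dot V for conjc}).
Variables (W : finGroupType) (rho : W -> 'End(V)) (S : {set W}) (alpha : W -> V).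
Hypothesis HW : coxeter_reflection_group form rho S alpha.
Variable sigma : {set W} -> R.
Hypothesis sigma_gt0 : forall I : {set W}, I \subset S -> 0 < sigma I.
Variable e : {set W} -> galg R[i] W.
Hypothesis He : e_system rho S alpha sigma e.

Local Notation C := R[i].
Local Notation mcr := (min_coset_reps S).
Local Notation smap := (smap rho alpha).
Local Notation gelt := (gelt C).
Local Notation x_ := (x_ R S).
Local Notation m_ := (m_ rho S alpha sigma).
Local Notation f K := (gres <<K>>%g (e K)).

Lemma e_mul_x (I L : {set W}) : I \subset S -> L \subset S ->
  f I * x_ L = \sum_(d in mcr L | smap d^-1%g I L) f I * gelt d.
Proof.
move=> IS LS; have := f_mul_x HW (e := e) IS LS (subxx S).
rewrite (gen_simple HW) gresT => ->.
  by apply: eq_bigl => d; rewrite finset.in_setT.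
move=> M MI; exact: (f_kill HW sigma_gt0 He IS MI).
Qed.

(** Multiply the expansion of [1] in [W_L] by [f_L], which kills all terms but its
    own. *)
Lemma f_idem (L : {set W}) : L \subset S -> (m_ L L)%:C *: (f L * f L) = f L.
Proof.
move=> LS; rewrite -[RHS]mulr1 -(gres_x1 HW LS).
rewrite [in RHS](x_proper He LS) gresD gresZ gres_sum mulrDr -scalerAr.
rewrite [X in _ = _ + X]mulr_sumr [X in _ = _ + X]big1 ?addr0 // => J JL.
rewrite gresZ -scalerAr (gres_e HW sigma_gt0 He (proper_sub JL) LS) mulrA.
by rewrite (f_kill HW sigma_gt0 He LS JL) mul0r scaler0.
Qed.

Variables (lambda : set {vspace V}) (L : {set W}).
Hypothesis lam : lattice_orbits rho lambda.
Hypothesis HL : L \in S_ rho S lambda.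

Local Notation e_lam := (e_orb rho S sigma e lambda).

Let LS : L \subset S. Proof. by move: HL; rewrite inE => /andP[]. Qed.

Lemma S_sub (I : {set W}) : I \in S_ rho S lambda -> I \subset S.
Proof. by rewrite inE => /andP[]. Qed.

Lemma e_orbit_gelt (I : {set W}) : I \in S_ rho S lambda ->
  exists d, e I = e L * gelt d.
Proof.
move=> HI; have [d [dL dE]] := same_orbit_simple HW lam HI HL.
exists d^-1%g; rewrite -(e_conj HW sigma_gt0 He LS (d := d)).
  by rewrite dE -mulrA -geltM mulgV gelt1 mulr1.
exact: smap_subr (S_sub HI) dL.
Qed.

(** Since [I] and [L] have the same size, an element that sends the simple roots of
    [I] into those of [L] matches them, and right translates [e_I] to [e_L]. *)
Lemma e_orbit_mul_x (I : {set W}) : I \in S_ rho S lambda ->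
  e I * x_ L = #|[set d in mcr L | smap d^-1%g I L]|%:R *: e L.
Proof.
move=> HI; have IS := S_sub HI.
rewrite {1}(e_factor HW sigma_gt0 He (subxx I) IS) -mulrA e_mul_x // mulr_sumr.
rewrite (eq_bigr (fun=> e L)) => [|d /andP[dL dI]].
  rewrite sumr_const scaler_nat; congr (_ *+ _).
  by apply: eq_card => d; rewrite [RHS]finset.in_set.
rewrite mulrA -(e_factor HW sigma_gt0 He (subxx I) IS).
have dIL : (I :^ d)%g = L.
  have := smap_conj_sub dI; rewrite invgK => sub.
  apply/eqP; rewrite eqEcard sub cardJg /=.
  have [d' [_ <-]] := same_orbit_simple HW lam HI HL.
  by rewrite cardJg.
rewrite -(e_conj HW sigma_gt0 He IS (d := d^-1%g)); last exact: smap_subr dI.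
by rewrite invgK dIL -mulrA -geltM mulVg gelt1 mulr1.
Qed.

Lemma e_orb_mul_x : exists2 c : C, c != 0 & e_lam * x_ L = c *: e L.
Proof.
exists (\sum_(I in S_ rho S lambda)
  (sigma I)%:C * #|[set d in mcr L | smap d^-1%g I L]|%:R); last first.
  rewrite /e_orb mulr_suml scaler_suml; apply: eq_bigr => I HI.
  by rewrite -scalerAl e_orbit_mul_x // scalerA.
rewrite gt_eqF // (bigD1 L) //= ltr_pwDl //.
  rewrite mulr_gt0 ?ltcR ?sigma_gt0 // ltr0n; apply/card_gt0P; exists 1%g.
  by rewrite finset.in_set invg1 (mcr1 HW) // (smap1 HW) /=.
apply: sumr_ge0 => I /andP[HI _].
by rewrite mulr_ge0 ?ler0n // lecR ltW // sigma_gt0 // S_sub.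
Qed.

(** [e_lambda C W = e_L C W]: each [e_I] is a right translate of [e_L], and [e_L]
    is obtained back from [e_lambda] through [x_L]. *)
Lemma mem_E_orb u :
  reflect (exists y, u = e L * y) (u \in E_orb rho S sigma e lambda).
Proof.
apply: (iffP (mem_line_prodv _ _ _)) => [[y _ ->]|[y ->]].
  exists (\sum_(I in S_ rho S lambda)
    (sigma I)%:C *: (gelt (xget 1%g [set d | e I = e L * gelt d]%classic) * y)).
  rewrite /e_orb mulr_suml mulr_sumr; apply: eq_bigr => I HI.
  rewrite -scalerAl -scalerAr mulrA; congr (_ *: (_ * _)).
  by case: xgetP => [d _ //|/(_ _)]; have [d ->] := e_orbit_gelt HI => /(_ d) [].
have [c c0 cE] := e_orb_mul_x; exists (c^-1 *: (x_ L * y)); first exact: memvf.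
by rewrite -scalerAr mulrA cE -scalerAl scalerA mulVf // scale1r.
Qed.

Lemma mem_eCW u :
  reflect (exists2 v, gres <<L>>%g v = v & u = e L * v) (u \in eCW_ e L).
Proof.
apply: (iffP (mem_line_prodv _ _ _)) => [[v /mem_galg_of vL ->]|[v vL ->]];
  by exists v => //; apply/mem_galg_of.
Qed.

(** [N_W(W_L) = N_L W_L] with [N_L] the set of elements that permute the simple
    roots of [L]; those fix [e_L] on the right. *)
Lemma eCW_normaliser u n : u \in eCW_ e L -> n \in 'N(<<L>>)%g ->
  u * gelt n \in eCW_ e L.
Proof.
move=> /mem_eCW[v vL ->] nN; apply/mem_eCW.
have [dL dE] := normaliser_parabolic HW LS nN; set d := mrep _ _ _ in dL dE * => dn.
exists (gelt (d^-1 * n)%g * (gelt n^-1%g * v * gelt n)).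
  by rewrite gresM ?gres_geltP ?gres_conj.
have eLd : e L * gelt d = e L.
  rewrite -{1}dE (e_conj HW sigma_gt0 He) //; exact: smap_subr dL.
have nE : v * gelt n
    = gelt d * (gelt (d^-1 * n)%g * (gelt n^-1%g * v * gelt n)).
  by rewrite !mulrA -!geltM mulKVg mulgV gelt1 mul1r.
by rewrite -[LHS]mulrA nE [LHS]mulrA eLd.
Qed.

(** On [e_L v = x_L f_L v], left multiplication by [f_L] gives the sum of the
    [f_L d f_L v] for [d] permuting the simple roots of [L]. Such [d] normalize
    [W_L], and only [d = 1] contributes to the part supported on [W_L], which is
    thus a nonzero multiple of [f_L v]. *)
Lemma f_mul_eCW u : u \in eCW_ e L ->
  gres 'N(<<L>>)%g (f L * u) = f L * u /\ (f L * u = 0 -> u = 0).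
Proof.
case/mem_eCW=> v vL ->.
have fvL : gres <<L>>%g (f L * v) = f L * v by rewrite gresM ?gres_id.
have eLv : e L * v = x_ L * (f L * v).
  by rewrite {1}(e_factor HW sigma_gt0 He (subxx L) LS) mulrA.
have fE : f L * (e L * v)
    = \sum_(d in mcr L | smap d^-1%g L L) f L * gelt d * (f L * v).
  by rewrite eLv mulrA (e_mul_x LS LS) mulr_suml.
have dN d : smap d^-1%g L L -> d \in 'N(<<L>>)%g.
  move=> dL; apply/normP; have := smap_conj_sub dL; rewrite invgK => Ld.
  by rewrite -genJ; congr <<_>>%g; apply/eqP; rewrite eqEcard Ld cardJg /=.
split.
  rewrite fE gres_sum; apply: eq_bigr => d /andP[_ /dN dL].
  have LN u' : gres <<L>>%g u' = u' -> gres 'N(<<L>>)%g u' = u'.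
    by apply: gres_sub; apply: normG.
  apply: (gresM _ (LN _ _ fvL)); apply: (gresM _ (gres_geltP _ dL)).
  exact: (LN _ _ (gres_id _ _)).
move=> f0; rewrite eLv; suff -> : f L * v = 0 by rewrite mulr0.
rewrite -(f_idem LS) -scalerAl -mulrA; apply/eqP; rewrite scaler_eq0; apply/orP; right.
have := congr1 (gres <<L>>%g) f0; rewrite fE gres_sum linear0.
rewrite (bigD1 1%g) /=; last by rewrite invg1 (mcr1 HW) // (smap1 HW) subxx.
rewrite gelt1 mulr1 gresM ?gres_id // big1 ?addr0 => [-> //|d].
case/andP=> /andP[dL _] dN1; rewrite gres_mulr // gres_mull ?gres_id // gres_gelt.
case: ifP => [dI|_]; last by rewrite mulr0 mul0r.
by rewrite (mcr_parabolic1 HW LS dI dL) eqxx in dN1.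
Qed.

(** Left multiplication by [f_L] is injective on [e_L C W_L] and maps it to [C N],
    where [N] is the normalizer of [W_L]; so it separates the cosets [N w]. *)
Lemma eCW_free (u : W -> galg C W) : (forall w, u w \in eCW_ e L) ->
  \sum_w u w * gelt w = 0 -> \sum_(n in 'N(<<L>>)%g) u n * gelt n = 0.
Proof.
move=> uL u0; set z := LHS.
have zL : z \in eCW_ e L by apply: rpred_sum => n nN; apply: eCW_normaliser.
have [_] := f_mul_eCW zL; apply.
have := congr1 (fun y => gres 'N(<<L>>)%g (f L * y)) u0.
rewrite mulr0 linear0 mulr_sumr gres_sum => fu0.
rewrite -[RHS]fu0 /z mulr_sumr [LHS]big_mkcond /=; apply: eq_bigr => w _.
have [fuN _] := f_mul_eCW (uL w).
rewrite mulrA (gres_mull _ fuN) gres_gelt; case: ifP => _ //.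
by rewrite mulr0.
Qed.

End OrbitModule.

(** * A criterion for induced modules *)

Section InductionCriterion.
Variables (K : fieldType).

Lemma gen_lspan (U : lmodType K) (P : U -> Prop) u : P u -> u \in lspan P.
Proof.
move=> Pu; apply/asboolP; exists 1%N, (fun=> 1), (fun=> u).
by split=> //; rewrite big_ord1 scale1r.
Qed.

Lemma lspan_ker (U N : lmodType K) (P : U -> Prop) (phi : {linear U -> N}) u :
  (forall v, P v -> phi v = 0) -> u \in lspan P -> phi u = 0.
Proof.
move=> P0 /asboolP[n [c [v [Pv ->]]]]; rewrite linear_sum big1 // => i _.
by rewrite linearZ /= P0 // scaler0.
Qed.

(** The isomorphism goes to the quotient, in the direction of [lmod_iso] and
    [rmod_iso]; it is defined through a section of [phi]. *)
Lemma lquot_iso (U N : lmodType K) (P : U -> Prop) (phi : {linear U -> N}) :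
  (forall u, (u \in lspan P) = (phi u == 0)) -> (forall n, exists u, phi u = n) ->
  exists2 f : {linear N -> lquot P}, bijective f &
    forall u, f (phi u) = lquot_pi P u.
Proof.
move=> kerP /choice[sec secK].
have piE u v : phi u = phi v -> lquot_pi P u = lquot_pi P v.
  by move=> uv; apply/lquot_eqP; rewrite kerP linearB /= uv subrr.
pose f n := lquot_pi P (sec n).
have f_lin : linear f.
  move=> k n n'; rewrite /f -[k *: lquot_pi _ _]lquot_piZ -lquot_piD; apply: piE.
  by rewrite secK linearP /= !secK.
pose fL : {linear N -> lquot P} := HB.pack f (GRing.isLinear.Build _ _ _ _ f f_lin).
have fphi u : fL (phi u) = lquot_pi P u by apply: piE; rewrite secK.
exists fL => //; exists (fun x => phi (lquot_repr x)) => [n|x].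
  apply/eqP; rewrite -[X in _ == X]secK -subr_eq0 -linearB -kerP.
  by apply/lquot_eqP; rewrite lquot_reprK.
by rewrite fphi lquot_reprK.
Qed.

Variables (G : finGroupType) (M : lmodType K).
Implicit Types (F : {ffun G -> M}).

Fact gtens_additive g : {morph @gtens K G M g : m n / m + n}.
Proof. by move=> m n; apply/ffunP => x; rewrite !ffunE; case: ifP; rewrite ?addr0. Qed.

Lemma gtens_sum g (I : Type) (r : seq I) (P : pred I) (E : I -> M) :
  @gtens K G M g (\sum_(i <- r | P i) E i) = \sum_(i <- r | P i) gtens g (E i).
Proof.
apply: (big_morph _ (@gtens_additive g)).
by apply/ffunP => x; rewrite !ffunE; case: ifP.
Qed.

Lemma gtensE F : F = \sum_g gtens g (F g).
Proof.
apply/ffunP => x; rewrite sum_ffunE (bigD1 x) //= big1 => [|g gx].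
  by rewrite !ffunE eqxx addr0.
by rewrite !ffunE eq_sym (negbTE gx).
Qed.

(** Here [r] selects coset representatives, and [a g] is the action of the element
    of [H] that relates [g] to [r g]. *)
Lemma gtens_lspan (P : {ffun G -> M} -> Prop) (r : G -> G) (a : G -> M -> M) F :
  (forall g m, gtens g m - gtens (r g) (a g m) \in lspan P) ->
  (forall c, \sum_(g | r g == c) a g (F g) = 0) -> F \in lspan P.
Proof.
move=> Pr F0; suff -> : F = \sum_g (gtens g (F g) - gtens (r g) (a g (F g))).
  by apply: rpred_sum => g _; apply: Pr.
rewrite sumrB -gtensE (partition_big r xpredT) //= big1 ?subr0 // => c _.
rewrite (eq_bigr (fun g => gtens c (a g (F g)))) => [|g /eqP -> //].
by rewrite -gtens_sum F0; apply/ffunP => x; rewrite !ffunE; case: ifP.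
Qed.

(** In both sections [iota_free] says that the translates of the image of [iota]
    over the cosets of [H] are independent: it is stated for the trivial coset, from
    which the other ones are obtained by translation. *)
Variables (H : {group G}) (N : lmodType K) (iota : {linear M -> N}).
Hypothesis iota_inj : injective iota.

Section Right.
Variables (act : M -> G -> M) (actN : N -> G -> N).
Hypothesis actN_linear : forall g, linear (actN^~ g).
Hypothesis actNM : forall n g h, actN n (g * h)%g = actN (actN n g) h.
Hypothesis iota_act : forall m h, h \in H -> iota (act m h) = actN (iota m) h.
Hypothesis iota_gen : forall n, exists F, n = \sum_g actN (iota (F g)) g.
Hypothesis iota_free : forall F, \sum_g actN (iota (F g)) g = 0 ->
  \sum_(h in H) actN (iota (F h)) h = 0.

Lemma rInd_iso : rmod_iso actN (rInd_act H act).
Proof.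
pose aN g : {linear N -> N} :=
  HB.pack (actN^~ g) (GRing.isLinear.Build _ _ _ _ _ (actN_linear g)).
have aNE g n : actN n g = aN g n by [].
pose phi F := \sum_g actN (iota (F g)) g.
have phi_lin : linear phi.
  move=> k F F'; rewrite scaler_sumr -big_split; apply: eq_bigr => g _.
  by rewrite !ffunE linearP /= !aNE linearP.
pose phiL : {linear {ffun G -> M} -> N} :=
  HB.pack phi (GRing.isLinear.Build _ _ _ _ phi phi_lin).
have phi_gtens g m : phi (gtens g m) = actN (iota m) g.
  rewrite /phi (bigD1 g) //= big1 => [|x xg].
    by rewrite !ffunE eqxx addr0.
  by rewrite !ffunE (negbTE xg) linear0 aNE linear0.
have phi_shift F g : phi [ffun y => F (y * g^-1)%g] = actN (phi F) g.
  rewrite aNE linear_sum /phi (reindex_inj (mulIg g)) /=; apply: eq_bigr => x _.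
  by rewrite ffunE mulgK actNM.
have kerP F : (F \in lspan (rInd_rel H act)) = (phiL F == 0).
  apply/idP/eqP => [|F0].
    apply: lspan_ker => _ [g [h [m [hH ->]]]]; rewrite linearB /=.
    by rewrite !phi_gtens actNM iota_act // subrr.
  pose r g := repr (H :* g)%g.
  have rg g : (g * (r g)^-1)%g \in H.
    by rewrite -mem_rcoset -rcoset_sym; apply: mem_repr_rcoset.
  apply: (gtens_lspan (r := r) (a := fun g m => act m (g * (r g)^-1)%g)) => [g m|c].
    apply: gen_lspan; exists (r g), (g * (r g)^-1)%g, m.
    by rewrite mulgKV; split.
  have [rc|rNc] := boolP (r c == c); last first.
    rewrite big1 // => g /eqP rgc; case/eqP: rNc; rewrite -{2}rgc /r.
    by congr repr; apply: rcoset_eqP; rewrite mem_rcoset -groupV invMg invgK -{1}rgc rg.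
  rewrite (reindex_inj (mulIg c)) /= (eq_bigl (mem H)) => [|h]; last first.
    apply/eqP/idP => [rhc|hH]; first by have := rg (h * c)%g; rewrite rhc mulgK.
    by rewrite /r rcosetM rcoset_id // -/(r c) (eqP rc).
  apply: iota_inj; rewrite linear0 linear_sum /=.
  have := iota_free (F := [ffun y => F (y * c^-1^-1)%g]).
  rewrite -/(phi _) phi_shift [phi F]F0 aNE linear0 => /(_ erefl) sum0.
  rewrite -[RHS]sum0.
  apply: eq_bigr => h hH; rewrite ffunE invgK.
  have -> : r (h * c)%g = c by rewrite /r rcosetM rcoset_id // -/(r c) (eqP rc).
  by rewrite mulgK iota_act.
have [|f f_bij fphi] := lquot_iso kerP.
  by move=> n; have [F ->] := iota_gen n; exists F.
exists f; split=> // n g; have [F nE] := iota_gen n.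
have -> : n = phiL (lquot_repr (f n)).
  apply: (bij_inj f_bij); rewrite fphi; exact/esym/lquot_reprK.
by rewrite -phi_shift -[phi _]/(phiL _) !fphi /rInd_act lquot_reprK.
Qed.
End Right.

Section Left.
Variables (act : G -> M -> M) (actN : G -> N -> N).
Hypothesis actN_linear : forall g, linear (actN g).
Hypothesis actNM : forall n g h, actN (g * h)%g n = actN g (actN h n).
Hypothesis iota_act : forall m h, h \in H -> iota (act h m) = actN h (iota m).
Hypothesis iota_gen : forall n, exists F, n = \sum_g actN g (iota (F g)).
Hypothesis iota_free : forall F, \sum_g actN g (iota (F g)) = 0 ->
  \sum_(h in H) actN h (iota (F h)) = 0.

Lemma lInd_iso : lmod_iso actN (lInd_act H act).
Proof.
pose aN g : {linear N -> N} :=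
  HB.pack (actN g) (GRing.isLinear.Build _ _ _ _ _ (actN_linear g)).
have aNE g n : actN g n = aN g n by [].
pose phi F := \sum_g actN g (iota (F g)).
have phi_lin : linear phi.
  move=> k F F'; rewrite scaler_sumr -big_split; apply: eq_bigr => g _.
  by rewrite !ffunE linearP /= !aNE linearP.
pose phiL : {linear {ffun G -> M} -> N} :=
  HB.pack phi (GRing.isLinear.Build _ _ _ _ phi phi_lin).
have phi_gtens g m : phi (gtens g m) = actN g (iota m).
  rewrite /phi (bigD1 g) //= big1 => [|x xg].
    by rewrite !ffunE eqxx addr0.
  by rewrite !ffunE (negbTE xg) linear0 aNE linear0.
have phi_shift F g : phi [ffun y => F (g^-1 * y)%g] = actN g (phi F).
  rewrite aNE linear_sum /phi (reindex_inj (mulgI g)) /=; apply: eq_bigr => x _.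
  by rewrite ffunE mulKg actNM.
have kerP F : (F \in lspan (lInd_rel H act)) = (phiL F == 0).
  apply/idP/eqP => [|F0].
    apply: lspan_ker => _ [g [h [m [hH ->]]]]; rewrite linearB /=.
    by rewrite !phi_gtens actNM iota_act // subrr.
  pose r g := repr (g *: H)%g.
  have rg g : ((r g)^-1 * g)%g \in H.
    rewrite -mem_lcoset; have : r g \in (g *: H)%g by apply/mem_repr/lcoset_refl.
    by move/lcoset_eqP => ->; apply: lcoset_refl.
  apply: (gtens_lspan (r := r) (a := fun g m => act ((r g)^-1 * g)%g m)) => [g m|c].
    apply: gen_lspan; exists (r g), ((r g)^-1 * g)%g, m.
    by rewrite mulKVg; split.
  have [rc|rNc] := boolP (r c == c); last first.
    rewrite big1 // => g /eqP rgc; case/eqP: rNc; rewrite -{2}rgc /r.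
    by congr repr; apply: lcoset_eqP; rewrite mem_lcoset -groupV invMg invgK -{1}rgc rg.
  rewrite (reindex_inj (mulgI c)) /= (eq_bigl (mem H)) => [|h]; last first.
    apply/eqP/idP => [rhc|hH]; first by have := rg (c * h)%g; rewrite rhc mulKg.
    by rewrite /r lcosetM lcoset_id // -/(r c) (eqP rc).
  apply: iota_inj; rewrite linear0 linear_sum /=.
  have := iota_free (F := [ffun y => F (c^-1^-1 * y)%g]).
  rewrite -/(phi _) phi_shift [phi F]F0 aNE linear0 => /(_ erefl) sum0.
  rewrite -[RHS]sum0.
  apply: eq_bigr => h hH; rewrite ffunE invgK.
  have -> : r (c * h)%g = c by rewrite /r lcosetM lcoset_id // -/(r c) (eqP rc).
  by rewrite mulKg iota_act.
have [|f f_bij fphi] := lquot_iso kerP.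
  by move=> n; have [F ->] := iota_gen n; exists F.
exists f; split=> // g n.
have -> : n = phiL (lquot_repr (f n)).
  apply: (bij_inj f_bij); rewrite fphi; exact/esym/lquot_reprK.
by rewrite -phi_shift -[phi _]/(phiL _) !fphi /lInd_act lquot_reprK.
Qed.
End Left.

End InductionCriterion.

(** * The right module E_lambda *)

Section OrbitModuleInduced.
Variables (R : realType) (V : vectType R[i]) (form : {dot V for conjc}).
Variables (W : finGroupType) (rho : W -> 'End(V)) (S : {set W}) (alpha : W -> V).
Hypothesis HW : coxeter_reflection_group form rho S alpha.
Variable sigma : {set W} -> R.
Hypothesis sigma_gt0 : forall I : {set W}, I \subset S -> 0 < sigma I.
Variable e : {set W} -> galg R[i] W.
Hypothesis He : e_system rho S alpha sigma e.
Variables (lambda : set {vspace V}) (L : {set W}).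
Hypothesis lam : lattice_orbits rho lambda.
Hypothesis HL : L \in S_ rho S lambda.

Lemma E_orb_induced :
  let N : {set W} := 'N(<<L>>)%g in
   exists actL : subvs_of (eCW_ e L) -> W -> subvs_of (eCW_ e L),
     (forall u n, n \in N -> vsval (actL u n) = vsval u * gelt _ n) /\
     exists actE : subvs_of (E_orb rho S sigma e lambda) -> W ->
                   subvs_of (E_orb rho S sigma e lambda),
       (forall u w, vsval (actE u w) = vsval u * gelt _ w) /\
       rmod_iso actE (rInd_act N actL).
Proof.
pose actL (u : subvs_of (eCW_ e L)) n : subvs_of (eCW_ e L) :=
  vsproj _ (vsval u * gelt _ n).
pose E := E_orb rho S sigma e lambda.
pose actE (u : subvs_of E) w : subvs_of E := vsproj _ (vsval u * gelt _ w).
have memE := mem_E_orb HW sigma_gt0 He lam HL.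
have actLE u n : n \in 'N(<<L>>)%g -> vsval (actL u n) = vsval u * gelt _ n.
  move=> nN; apply: vsprojK.
  exact: (eCW_normaliser HW sigma_gt0 He HL (subvsP u) nN).
have actEE u w : vsval (actE u w) = vsval u * gelt _ w.
  apply: vsprojK; have /memE[y ->] := subvsP u; apply/memE.
  by exists (y * gelt _ w); rewrite mulrA.
exists actL; split=> //; exists actE; split=> //.
pose io (u : subvs_of (eCW_ e L)) : subvs_of E := vsproj E (vsval u).
have ioE u : vsval (io u) = vsval u.
  apply: vsprojK; have /mem_eCW[y _ ->] := subvsP u; apply/memE.
  by exists y.
have io_lin : linear io by move=> k u v; rewrite /io !linearP.
pose iota : {linear subvs_of (eCW_ e L) -> subvs_of E} :=
  HB.pack io (GRing.isLinear.Build _ _ _ _ io io_lin).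
have sumE (I : Type) (r : seq I) (P : pred I) (F : I -> subvs_of E) :
    vsval (\sum_(i <- r | P i) F i) = \sum_(i <- r | P i) vsval (F i).
  exact: linear_sum.
apply: (rInd_iso (H := 'N(<<L>>)%G) (iota := iota)).
- by move=> u v /(congr1 vsval); rewrite !ioE => /val_inj.
- by move=> w k u v; rewrite /actE !linearP /= mulrDl -scalerAl linearP.
- by move=> u g h; apply: val_inj; rewrite /= !actEE geltM mulrA.
- by move=> u h hN; apply: val_inj; rewrite /= actEE !ioE actLE.
- move=> u; have /memE[y uE] := subvsP u.
  have eL : e L \in eCW_ e L.
    by apply/mem_eCW; exists 1; rewrite ?mulr1 // -gelt1 gres_geltP.
  exists [ffun w => y w *: vsproj _ (e L)]; apply: val_inj.
  rewrite -[RHS]/(vsval _) sumE /= uE.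
  rewrite {1}(galgE y) mulr_sumr; apply: eq_bigr => w _.
  by rewrite actEE ioE ffunE linearZ /= vsprojK // -scalerAl -scalerAr.
- move=> F /(congr1 vsval); rewrite sumE linear0 => F0; apply: val_inj.
  rewrite -[LHS]/(vsval _) sumE [RHS]linear0.
  rewrite -[RHS](eCW_free HW sigma_gt0 He HL (u := fun w => vsval (F w))).
  - by apply: eq_bigr => w _; rewrite actEE ioE.
  - by move=> w; apply: subvsP.
  by rewrite -[RHS]F0; apply: eq_bigr => w _; rewrite actEE ioE.
Qed.

End OrbitModuleInduced.

(** * Projections of the Orlik-Solomon algebra *)

Section NonCommutativeProducts.
Variable A : nzRingType.

Lemma prod_seq_eq0 (I : eqType) (r : seq I) (P : pred I) (F : I -> A) i :
  i \in r -> P i -> F i = 0 -> \prod_(j <- r | P j) F j = 0.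
Proof.
elim: r => // j r IH; rewrite in_cons big_cons => /orP[/eqP <-|ir] Pi Fi.
  by rewrite Pi Fi mul0r.
by rewrite IH // mulr0; case: ifP.
Qed.

Lemma prod_lift n (h : 'I_n.+1) (F : 'I_n.+1 -> A) :
  \prod_(j | j != h) F j = \prod_(k < n) F (lift h k).
Proof.
elim: n h F => [|n IH] h F.
  by rewrite big_ord0 big_pred0 // => j; rewrite !ord1 eqxx.
rewrite big_mkcond [LHS]big_ord_recl /=.
have [h' ->|->] := unliftP ord0 h; last first.
  by rewrite /= mul1r; apply: eq_bigr.
rewrite [RHS]big_ord_recl /=; congr (F _ * _); first exact: val_inj.
rewrite [RHS](eq_bigr (fun k => F (lift ord0 (lift h' k)))) => [|k _]; last first.
  by congr F; apply: val_inj; rewrite /= /bump !add1n ltnS; case: leqP.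
rewrite -(IH h' (fun j => F (lift ord0 j))) -big_mkcond.
by apply: eq_bigl => j; rewrite (inj_eq (@lift_inj _ ord0)).
Qed.

Lemma mul_if (x y : A) (b c : bool) :
  (if b then x else 0) * (if c then y else 0) = if b && c then x * y else 0.
Proof. by case: b c => [] []; rewrite ?mul0r ?mulr0. Qed.

Lemma anticomm_if (x y : A) (b c : bool) : x * y = - (y * x) ->
  (if b then x else 0) * (if c then y else 0)
  = - ((if c then y else 0) * (if b then x else 0)).
Proof. by move=> xy; rewrite !mul_if andbC; case: ifP; rewrite ?oppr0. Qed.

End NonCommutativeProducts.

Section OrlikSolomonAlgebra.
Variables (R : realType) (V : vectType R[i]) (form : {dot V for conjc}).
Variables (W : finGroupType) (rho : W -> 'End(V)) (S : {set W}) (alpha : W -> V).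
Hypothesis HW : coxeter_reflection_group form rho S alpha.
Variables (A : algType R[i]) (a : W -> A).
Hypothesis HA : os_algebra form rho a.

Local Notation refl := (reflections rho).
Local Notation Fix := (Fix rho).

Let HR : os_relations form rho a. Proof. by case: HA. Qed.

Lemma os_sqr t : t \in refl -> a t * a t = 0.
Proof.
move=> tT; have /eqP := HR.1 t t tT tT; rewrite -addr_eq0 -mulr2n -scaler_nat.
by rewrite scaler_eq0 pnatr_eq0 => /eqP.
Qed.

(** Multiplying the relation of a dependent family by its first generator leaves
    only the product of the whole family. *)
Lemma os_prod_dependent p (t : 'I_p -> W) : (forall i, t i \in refl) ->
  dependent_hyperplanes form rho t -> \prod_(i < p) a (t i) = 0.
Proof.
case: p t => [|p] t tT tdep.
  by case: tdep => v _; rewrite (tuple0 v) nil_free.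
have := congr1 ( *%R (a (t ord0))) (HR.2 _ t tT tdep).
rewrite mulr0 mulr_sumr [\sum_(i < _) _]big_ord_recl /= [X in _ + X]big1 ?addr0 => [|k _].
  move/eqP; rewrite expr1 mulN1r mulrN prod_lift oppr_eq0.
  by rewrite [X in _ -> X = _]big_ord_recl => /eqP.
rewrite big_mkcond [X in _ * (_ * X)]big_ord_recl /=.
rewrite mulrA commr_sign -mulrA (mulrA (a _)).
by rewrite os_sqr // mul0r mulr0.
Qed.

Lemma orthov_anti (X Y : {vspace V}) :
  (X <= Y)%VS -> (orthov form Y <= orthov form X)%VS.
Proof. by move=> XY; rewrite orthov_sym orthovK. Qed.

(** The normal of a hyperplane not containing [Z] is not in the span of those of
    hyperplanes containing [Z], which are orthogonal to [Z]. *)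
Lemma dependent_lift p (t : 'I_p.+1 -> W) (h : 'I_p.+1) (Z : {vspace V}) :
  dependent_hyperplanes form rho t -> ~~ (Z <= Fix (t h))%VS ->
  (forall k, (Z <= Fix (t (lift h k)))%VS) ->
  dependent_hyperplanes form rho (t \o lift h).
Proof.
case=> v vt nfree Zh Zk; exists [tuple tnth v (lift h k) | k < p].
  by move=> i; rewrite tnth_mktuple vt.
apply: contra nfree => /= free'.
have /perm_free -> : perm_eq v (tnth v h :: [seq tnth v (lift h k) | k <- enum 'I_p]).
  rewrite -{1}(map_tnth_enum v).
  rewrite [X in perm_eq _ (_ :: X)](map_comp (tnth v)) -map_cons; apply: perm_map.
  apply: uniq_perm; first exact: enum_uniq.
    rewrite /= (map_inj_uniq (@lift_inj _ h)) enum_uniq andbT.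
    by apply/mapP => -[k _ /eqP]; rewrite (negbTE (neq_lift _ _)).
  move=> j; rewrite mem_enum in_cons; have [k ->|->] := unliftP h j.
    by rewrite map_f ?orbT // mem_enum.
  by rewrite eqxx.
rewrite free_cons free' andbT; apply: contra Zh => vh.
rewrite -(orthovK form (Fix _)) -vt orthov_sym -memvE.
apply: subvP vh; apply/span_subvP => _ /mapP[k _ ->].
rewrite memvE vt; exact: orthov_anti.
Qed.

(** In the relation of a dependent family, at most the term that omits [h] is left
    if [Z] is not contained in the hyperplane of [h]. If all other hyperplanes
    contain [Z], they are still dependent, so that this term vanishes in [A]. *)
Lemma os_relations_above (Z : {vspace V}) :
  os_relations form rho (fun t => if (Z <= Fix t)%VS then a t else 0).
Proof.
set b := fun t => _.
have bE t : b t = if (Z <= Fix t)%VS then a t else 0 by [].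
move: b bE => b bE; split=> [t u tT uT|p t tT tdep].
  by rewrite (bE t) (bE u); apply/anticomm_if/HR.1.
have [/forallP Zt|/forallPn[h Zh]] := boolP [forall i, (Z <= Fix (t i))%VS].
  rewrite -[RHS](HR.2 _ t tT tdep); apply: eq_bigr => i _; congr (_ * _).
  by apply: eq_bigr => j _; rewrite bE Zt.
apply: big1 => i _; have bh : b (t h) = 0 by rewrite bE (negbTE Zh).
have [->{i}|hi] := eqVneq i h; last first.
  by rewrite (prod_seq_eq0 (mem_index_enum h) _ bh) ?mulr0 // eq_sym.
case: p t tT tdep h Zh bh => [|p] t tT tdep h Zh bh; first by case: h {Zh bh}.
rewrite prod_lift; have [/forallP Zt|/forallPn[k Zk]] :=
    boolP [forall k, (Z <= Fix (t (lift h k)))%VS]; last first.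
  by rewrite (prod_seq_eq0 (mem_index_enum k)) ?mulr0 // bE (negbTE Zk).
rewrite (eq_bigr (fun k => a ((t \o lift h) k))) => [|k _]; last by rewrite bE Zt.
rewrite os_prod_dependent ?mulr0 // => [k|]; first exact: tT.
exact: (dependent_lift tdep Zh Zt).
Qed.

Lemma subv_bigcap_seq (Z : {vspace V}) (ts : seq W) :
  (Z <= \bigcap_(t <- ts) Fix t)%VS = all (fun t => Z <= Fix t)%VS ts.
Proof.
by elim: ts => [|t ts IH]; rewrite ?big_nil ?subvf // big_cons subv_cap IH.
Qed.

(** [Z] is contained in an intersection of hyperplanes if and only if it is
    contained in each of them. *)
Lemma os_projection (Z : {vspace V}) : exists f : {lrmorphism A -> A},
  forall X y, y \in lspan (os_monomial rho a X) ->
    f y = if (Z <= X)%VS then y else 0.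
Proof.
have [[f fE] _] := HA.2 A _ (os_relations_above Z).
have fM x y : f (x * y) = f x * f y by apply: rmorphM.
exists f => X y.
have fmon y' : os_monomial rho a X y' -> f y' = if (Z <= X)%VS then y' else 0.
  case=> ts [tsT tsX ->]; rewrite -tsX subv_bigcap_seq {tsX}.
  elim: ts tsT => [|t ts IH] tsT; first by rewrite !big_nil rmorph1.
  have tT : t \in refl by rewrite tsT ?mem_head.
  have {}IH := IH (fun u uts => tsT u (@mem_behead _ (t :: ts) u uts)).
  by rewrite !big_cons fM IH (fE t tT); apply: mul_if.
case/asboolP=> n [c [u [uX ->]]]; rewrite linear_sum /=.
case: ifP fmon => _ fmon; last rewrite big1 // => i _.
  by apply: eq_bigr => i _; rewrite linearZ /= fmon.
by rewrite linearZ /= fmon // scaler0.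
Qed.

Variables (act : W -> {lrmorphism A -> A}).
Hypothesis Hact : os_action rho a act.

Lemma mem_img w (X : {vspace V}) v : (v \in rho w @: X)%VS = (rho w^-1%g v \in X).
Proof.
apply/memv_imgP/idP => [[x xX ->]|vX]; first by rewrite (rhoK HW).
by exists (rho w^-1%g v); rewrite ?(rhoKV HW).
Qed.

Lemma Fix_conj w t : Fix (t ^ w^-1)%g = (rho w @: Fix t)%VS.
Proof.
apply/vspaceP => v; rewrite mem_img; apply/fixedSpaceP/fixedSpaceP => tv.
  by apply: (rho_inj HW (w := w)); rewrite (rhoKV HW) -[RHS]tv conjgE invgK !(rhoM HW).
by rewrite conjgE invgK !(rhoM HW) tv (rhoKV HW).
Qed.

Lemma dim_img w (X : {vspace V}) : \dim (rho w @: X) = \dim X.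
Proof.
apply: limg_dim_eq; apply/eqP; rewrite -subv0; apply/subvP => v.
rewrite memv_cap memv_ker memv0 => /andP[_ /eqP wv].
by apply/eqP; apply: (rho_inj HW (w := w)); rewrite wv linear0.
Qed.

Lemma refl_conj w t : t \in refl -> (t ^ w^-1)%g \in refl.
Proof. by rewrite !inE Fix_conj dim_img. Qed.

Lemma act1 y : act 1%g y = y.
Proof.
apply: ((HA.2 A a HR).2 (act 1%g) idfun) => t tT.
by rewrite Hact // invg1 mulg1 mul1g.
Qed.

Lemma actM u w y : act (u * w)%g y = act u (act w y).
Proof.
apply: ((HA.2 A a HR).2 (act (u * w)%g) (act u \o act w)) => t tT /=.
rewrite !Hact // ?mulgA ?invMg ?mulgA //.
by have := refl_conj w tT; rewrite conjgE invgK mulgA.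
Qed.

End OrlikSolomonAlgebra.

(** * The left module A_lambda *)

Lemma lspan_map (K : fieldType) (U U' : lmodType K) (f : {linear U -> U'})
    (P : U -> Prop) (Q : U' -> Prop) u :
  (forall v, P v -> f v \in lspan Q) -> u \in lspan P -> f u \in lspan Q.
Proof.
move=> PQ /asboolP[n [c [v [Pv ->]]]]; rewrite linear_sum.
by apply: rpred_sum => i _; rewrite linearZ; apply/rpredZ/PQ.
Qed.

Section FlatModules.
Variables (R : realType) (V : vectType R[i]) (form : {dot V for conjc}).
Variables (W : finGroupType) (rho : W -> 'End(V)) (S : {set W}) (alpha : W -> V).
Hypothesis HW : coxeter_reflection_group form rho S alpha.
Variables (A : algType R[i]) (a : W -> A).
Hypothesis HA : os_algebra form rho a.
Variables (act : W -> {lrmorphism A -> A}).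
Hypothesis Hact : os_action rho a act.

Local Notation refl := (reflections rho).
Local Notation Fix := (Fix rho).
Local Notation flat X := (lspan (os_monomial rho a X)).

Lemma memv_bigcap_seq (ts : seq W) v :
  (v \in \bigcap_(t <- ts) Fix t)%VS = all (fun t => v \in Fix t) ts.
Proof. by rewrite memvE subv_bigcap_seq; apply: eq_all => t; rewrite memvE. Qed.

Lemma act_prod w (ts : seq W) : {subset ts <= refl} ->
  act w (\prod_(t <- ts) a t) = \prod_(t <- [seq (t ^ w^-1)%g | t <- ts]) a t.
Proof.
have actwM x z : act w (x * z) = act w x * act w z by apply: rmorphM.
elim: ts => [|t ts IH] tsT; first by rewrite !big_nil; apply: rmorph1.
have tT : t \in refl by rewrite tsT ?mem_head.
have {}IH := IH (fun u uts => tsT u (@mem_behead _ (t :: ts) u uts)).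
rewrite map_cons !big_cons actwM IH Hact //; congr (a _ * _).
by rewrite conjgE invgK mulgA.
Qed.

Lemma act_flat w X y : y \in flat X -> act w y \in flat (rho w @: X)%VS.
Proof.
apply: lspan_map => {}y [ts [tsT tsX ->]]; apply: gen_lspan.
exists [seq (t ^ w^-1)%g | t <- ts]; split.
- by move=> _ /mapP[t tts ->]; rewrite (refl_conj HW) // tsT.
- rewrite -tsX; apply/vspaceP => v; rewrite (mem_img HW) !memv_bigcap_seq all_map.
  by apply: eq_all => t /=; rewrite (Fix_conj HW) (mem_img HW).
- exact: act_prod.
Qed.

Variables (lambda : set {vspace V}) (X : {vspace V}).
Hypothesis lam : lattice_orbits rho lambda.
Hypothesis HX : lambda X.

Lemma orbit_img w Y : lambda Y -> lambda (rho w @: Y)%VS.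
Proof.
case: lam => Z _ <- [u _ <-]; exists (w * u)%g => //.
by rewrite (img_rhoM HW).
Qed.

Lemma orbit_part_act w y : y \in lspan (os_orbit_part rho a lambda) ->
  act w y \in lspan (os_orbit_part rho a lambda).
Proof.
apply: lspan_map => {}y [Y lY yY]; apply: gen_lspan.
by exists (rho w @: Y)%VS; [apply: orbit_img | apply: act_flat].
Qed.

(** [X] is an intersection of hyperplanes of reflections in [pstab rho X]. *)
Lemma flat_closed v : {in pstab rho X, forall u, rho u v = v} -> v \in X.
Proof.
case: lam => Y [B [BT YB]] lE; move: HX; rewrite -lE => -[w _ <-] fixv.
rewrite (mem_img HW) YB memvE; apply/subv_bigcapP => t tB.
rewrite -memvE; apply/fixedSpaceP.
apply: (rho_inj HW (w := w)); rewrite (rhoKV HW) -{2}(fixv (t ^ w^-1)%g).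
  by rewrite conjgE invgK !(rhoM HW).
rewrite (pstab_img HW) memJ_conjg inE YB; exact: (bigcapv_inf t tB (subvv _)).
Qed.

(** By [flat_closed], [X] is the fixed space of its pointwise stabilizer. *)
Lemma normaliser_flat n : (n \in 'N(pstab rho X)%g) = ((rho n @: X)%VS == X).
Proof.
apply/idP/eqP => [nN|nX]; last first.
  by rewrite -groupV; apply/normP; rewrite -(pstab_img HW) nX.
have nX : pstab rho (rho n @: X)%VS = pstab rho X.
  by rewrite (pstab_img HW); apply: (normP _); rewrite groupV.
apply/eqP; rewrite eqEdim (dim_img HW) leqnn andbT; apply/subvP => v vX.
apply: flat_closed => u; rewrite -nX => /pstabP; exact.
Qed.

(** For the independence of the translates of [A_X], apply the projection attached
    to [X]: since all elements of the orbit have the same dimension, it only keeps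
    the summands [w A_X] with [w X = X]. *)
Lemma A_orb_induced :
   let N : {set W} := 'N(pstab rho X)%g in
   exists actX : W -> A_flat rho a X -> A_flat rho a X,
     (forall n x, n \in N -> val (actX n x) = act n (val x)) /\
     exists actA : W -> A_orb rho a lambda -> A_orb rho a lambda,
       (forall w x, val (actA w x) = act w (val x)) /\
       lmod_iso actA (lInd_act N actX).
Proof.
have flatP (x : A_flat rho a X) : val x \in flat X by apply: valP.
have orbP (x : A_orb rho a lambda) : val x \in lspan (os_orbit_part rho a lambda).
  exact: valP.
pose actX n x : A_flat rho a X := insubd x (act n (val x)).
have actXE n x : n \in 'N(pstab rho X)%g -> val (actX n x) = act n (val x).
  rewrite normaliser_flat => /eqP nX; apply: insubdK.
  by have := act_flat n (flatP x); rewrite nX.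
pose actA w x : A_orb rho a lambda := LspanSub (orbit_part_act w (orbP x)).
have actAE w x : val (actA w x) = act w (val x) by [].
exists actX; split=> //; exists actA; split=> //.
have flat_orb Y y : lambda Y -> y \in flat Y -> y \in lspan (os_orbit_part rho a lambda).
  by move=> lY yY; apply: gen_lspan; exists Y.
pose io (x : A_flat rho a X) : A_orb rho a lambda := LspanSub (flat_orb X _ HX (flatP x)).
have io_lin : linear io by move=> k x y; apply: val_inj.
pose iota : {linear A_flat rho a X -> A_orb rho a lambda} :=
  HB.pack io (GRing.isLinear.Build _ _ _ _ io io_lin).
have sumE (I : Type) (r : seq I) (P : pred I) (F : I -> A_orb rho a lambda) :
    val (\sum_(i <- r | P i) F i) = \sum_(i <- r | P i) val (F i).
  exact: linear_sum.
have flat_sum n (P : pred 'I_n) (c : 'I_n -> R[i]) (x : 'I_n -> A_flat rho a X) :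
    val (\sum_(i | P i) c i *: x i) = \sum_(i | P i) c i *: val (x i).
  by rewrite linear_sum; apply: eq_bigr => i _; rewrite linearZ.
apply: (lInd_iso (H := 'N(pstab rho X)%G) (iota := iota)).
- by move=> x y xy; apply: val_inj; have := congr1 val xy.
- by move=> w k x y; apply: val_inj; rewrite actAE /= linearP.
- by move=> n g h; apply: val_inj; rewrite !actAE (actM HW HA Hact).
- by move=> m h hN; apply: val_inj; rewrite actAE /= actXE.
- move=> y; have /asboolP[n [c [u [uP yE]]]] := orbP y.
  have /choice[p pE] i : exists p : W * A_flat rho a X, u i = act p.1 (val p.2).
    have [Y lY uY] := uP i; have [w YE] := orbit_sym HW lam HX lY.
    have := act_flat w^-1%g uY; rewrite YE -(img_rhoM HW) mulVg (img_rho1 HW) => wu.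
    by exists (w, LspanSub wu); rewrite /= -(actM HW HA Hact) mulgV (act1 HA Hact).
  exists [ffun g => \sum_(i | (p i).1 == g) c i *: (p i).2]; apply: val_inj.
  rewrite sumE yE (partition_big (fun i => (p i).1) xpredT) //=.
  apply: eq_bigr => g _; rewrite ffunE -[lspan_val _]/(val _) flat_sum linear_sum.
  by apply: eq_bigr => i /eqP <-; rewrite pE -linearZ.
- move=> F /(congr1 val) F0; apply: val_inj; rewrite !sumE in F0 *.
  have [f fE] := os_projection HA X.
  have := congr1 f F0; rewrite !linear0 linear_sum /= => fF0.
  rewrite -[RHS]fF0 [LHS]big_mkcond /=; apply: eq_bigr => g _.
  rewrite (fE _ _ (act_flat g (flatP (F g)))) normaliser_flat.
  by rewrite eq_sym eqEdim (dim_img HW) leqnn andbT.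
Qed.
End FlatModules.

(** * Induced structure of E_lambda and A_lambda *)

Theorem proposition4p7 (R : realType)
  (V : vectType R[i]) (form : {dot V for conjc})
  (W : finGroupType) (rho : W -> 'End(V)) (S : {set W}) (alpha : W -> V)
  (HW : coxeter_reflection_group form rho S alpha)
  (A : algType R[i]) (a : W -> A) (HA : os_algebra form rho a)
  (act : W -> {lrmorphism A -> A}) (Hact : os_action rho a act)
  (sigma : {set W} -> R)
  (Hsigma : forall I : {set W}, I \subset S -> 0 < sigma I)
  (e : {set W} -> galg R[i] W) (He : e_system rho S alpha sigma e)
  (lambda : set {vspace V}) (Hlambda : lattice_orbits rho lambda)
  (X : {vspace V}) (HX : lambda X)
  (L : {set W}) (HL : L \in S_ rho S lambda) :
  (let N : {set W} := 'N(<<L>>)%g in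
   exists actL : subvs_of (eCW_ e L) -> W -> subvs_of (eCW_ e L),
     (forall u n, n \in N -> vsval (actL u n) = vsval u * gelt _ n) /\
     exists actE : subvs_of (E_orb rho S sigma e lambda) -> W ->
                   subvs_of (E_orb rho S sigma e lambda),
       (forall u w, vsval (actE u w) = vsval u * gelt _ w) /\
       rmod_iso actE (rInd_act N actL)) /\
  (let N : {set W} := 'N(pstab rho X)%g in
   exists actX : W -> A_flat rho a X -> A_flat rho a X,
     (forall n x, n \in N -> val (actX n x) = act n (val x)) /\
     exists actA : W -> A_orb rho a lambda -> A_orb rho a lambda,
       (forall w x, val (actA w x) = act w (val x)) /\
       lmod_iso actA (lInd_act N actX)).
Proof.
split; last exact: (A_orb_induced HW HA Hact Hlambda HX).
exact: (E_orb_induced HW Hsigma He Hlambda HL).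
Qed.
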